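(* Let $M^3=U\times J$ carry the warped product metric $$ds^2=E\,dx_1^2+2F\,dx_1dx_2+G\,dx_2^2+f(x_1,x_2)^2\,dx_3^2,$$ where $E,F,G,f$ are smooth functions of $(x_1,x_2)\in U$, $f>0$, and $E\,dx_1^2+2F\,dx_1dx_2+G\,dx_2^2$ is a Riemannian metric on $U$ with Gaussian curvature $K$. Put $\Delta=EG-F^2$, $f_i=\partial f/\partial x_i$ $(i=1,2)$, and let $H^f_{ij}$ be the components of the Hessian of $f$ with respect to the metric on $U$. Assume that $K\neq 0$ everywhere. (1) If $M^3$ can be isometrically embedded into $\mathbb{R}^4$, then the following two conditions hold: (i) $(H^f_{11}H^f_{22}-(H^f_{12})^2)K\geq 0$; (ii) $H^f_{11}H^f_{22}-(H^f_{12})^2+K(f_1^2G-2f_1f_2F+f_2^2E)=cK\Delta$ for some non-negative constant $c$. (2) Conversely, if the inequality $(H^f_{11}H^f_{22}-(H^f_{12})^2)K>0$ holds and the equality in (ii) holds for some constant $c$, then $c>0$ and $M^3$ can be locally isometrically embedded into $\mathbb{R}^4$ (each point has a neighborhood admitting an isometric embedding into $\mathbb{R}^4$).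
   Context: $U\subset\mathbb{R}^2$ is a simply connected open set with coordinates $(x_1,x_2)$ and $J\subset\mathbb{R}$ an open interval with coordinate $x_3$ (the paper works locally, in simply connected coordinate neighborhoods). The Hessian is $H^f_{ij}=\frac{\partial^2 f}{\partial x_i\partial x_j}-\sum_{k=1}^2\Gamma^k_{ij}f_k$, where $\Gamma_{ij}^k$ are the Christoffel symbols of the metric $E\,dx_1^2+2F\,dx_1dx_2+G\,dx_2^2$. An isometric embedding is a smooth embedding pulling back the standard Euclidean metric to the given metric. *)

(* Defs.v *)
From HB Require Import structures.
From mathcomp Require Import all_boot all_order all_algebra.
From mathcomp Require Import all_classical all_reals all_analysis.
Import Order.TTheory GRing.Theory Num.Theory.
Import numFieldNormedType.Exports.

Set Implicit Arguments.
Unset Strict Implicit.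
Unset Printing Implicit Defensive.

Local Open Scope classical_set_scope.
Local Open Scope ring_scope.

(* A path is a function on R of which only the restriction to [0, 1] matters. *)
Definition path_connected (R : realType) (T : topologicalType) (U : set T) :=
  U !=set0 /\
  forall x y, U x -> U y -> exists gamma : R -> T,
    [/\ {within `[0, 1], continuous gamma}, gamma @` `[0, 1] `<=` U,
        gamma 0 = x & gamma 1 = y].

Definition simply_connected (R : realType) (T : topologicalType) (U : set T) :=
  @path_connected R T U /\
  forall gamma : R -> T,
    {within `[0, 1], continuous gamma} -> gamma @` `[0, 1] `<=` U ->
    gamma 0 = gamma 1 ->
    exists h : R * R -> T,
      [/\ {within `[0, 1] `*` `[0, 1], continuous h},
          h @` (`[0, 1] `*` `[0, 1]) `<=` U,
          forall t, 0 <= t <= 1 -> h (0, t) = gamma t,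
          forall t, 0 <= t <= 1 -> h (1, t) = gamma 0 &
          forall s, 0 <= s <= 1 -> h (s, 0) = gamma 0 /\ h (s, 1) = gamma 0].

(* Indices are shifted by one: the coordinate x_(i+1) is [x 0 i]. *)
Definition pd (R : realType) n (i : 'I_n) (f : 'rV[R]_n -> R) : 'rV[R]_n -> R :=
  'D_(delta_mx 0 i) f.

Definition iter_pd (R : realType) n (s : seq 'I_n) (f : 'rV[R]_n -> R) :=
  foldr (@pd R n) f s.

(* C^oo on an open set: all iterated partial derivatives exist and are
   continuous there. *)
Definition smooth_on (R : realType) n (U : set 'rV[R]_n) (f : 'rV[R]_n -> R) :=
  forall (s : seq 'I_n) x, U x ->
    {for x, continuous (iter_pd s f)} /\
    forall i : 'I_n, derivable (iter_pd s f) x (delta_mx 0 i).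

Definition smooth_map_on (R : realType) n m (U : set 'rV[R]_n)
    (phi : 'rV[R]_n -> 'rV[R]_m) :=
  forall k, smooth_on U (fun x => phi x 0 k).

(* Row i is the partial derivative of phi in the direction i, as in the
   row-vector convention of [jacobian]. *)
Definition jac (R : realType) n m (phi : 'rV[R]_n -> 'rV[R]_m) (x : 'rV[R]_n) :
    'M[R]_(n, m) :=
  \matrix_(i, k) pd i (fun y => phi y 0 k) x.

Definition smooth_embedding (R : realType) n m (W : set 'rV[R]_n)
    (phi : 'rV[R]_n -> 'rV[R]_m) :=
  [/\ smooth_map_on W phi,
      forall x, W x -> row_free (jac phi x) &
      exists psi : 'rV[R]_m -> 'rV[R]_n,
        (forall x, W x -> psi (phi x) = x) /\
        {within phi @` W, continuous psi}].

Definition pullback_euclidean (R : realType) n m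
    (phi : 'rV[R]_n -> 'rV[R]_m) (x : 'rV[R]_n) : 'M[R]_n :=
  jac phi x *m (jac phi x)^T.

Definition isometric_embedding (R : realType) n m (W : set 'rV[R]_n)
    (g : 'rV[R]_n -> 'M[R]_n) (phi : 'rV[R]_n -> 'rV[R]_m) :=
  smooth_embedding W phi /\ forall x, W x -> pullback_euclidean phi x = g x.

Definition isometrically_embeds (R : realType) n m (W : set 'rV[R]_n)
    (g : 'rV[R]_n -> 'M[R]_n) :=
  exists phi : 'rV[R]_n -> 'rV[R]_m, isometric_embedding W g phi.

Definition locally_isometrically_embeds (R : realType) n m (M : set 'rV[R]_n)
    (g : 'rV[R]_n -> 'M[R]_n) :=
  forall p, M p -> exists W : set 'rV[R]_n,
    [/\ open W, W p, W `<=` M & isometrically_embeds m W g].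

Definition riemannian_metric (R : realType) n (U : set 'rV[R]_n)
    (g : 'rV[R]_n -> 'M[R]_n) :=
  (forall i j, smooth_on U (fun x => g x i j)) /\
  forall x, U x ->
    (g x)^T = g x /\ forall v : 'rV[R]_n, v != 0 -> 0 < (v *m g x *m v^T) 0 0.

Definition christoffel (R : realType) n (g : 'rV[R]_n -> 'M[R]_n)
    (k i j : 'I_n) (x : 'rV[R]_n) : R :=
  2^-1 * \sum_(l < n) (invmx (g x)) k l *
    (pd i (fun y => g y j l) x + pd j (fun y => g y i l) x
     - pd l (fun y => g y i j) x).

(* R(d_i, d_j) d_k = \sum_l (riemann g l i j k) d_l, with the sign convention
   R(X, Y) Z = D_X D_Y Z - D_Y D_X Z - D_[X, Y] Z. *)
Definition riemann (R : realType) n (g : 'rV[R]_n -> 'M[R]_n)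
    (l i j k : 'I_n) (x : 'rV[R]_n) : R :=
  pd i (christoffel g l j k) x - pd j (christoffel g l i k) x
  + \sum_(m < n) (christoffel g l i m x * christoffel g m j k x
                  - christoffel g l j m x * christoffel g m i k x).

(* K = <R(d_1, d_2) d_2, d_1> / det g; the sign is such that the round unit
   sphere has K = 1. *)
Definition gauss_curvature (R : realType) (g : 'rV[R]_2 -> 'M[R]_2)
    (x : 'rV[R]_2) : R :=
  (\sum_(l < 2) g x 0 l * riemann g l 0 1 1 x) / \det (g x).

Definition hess (R : realType) n (g : 'rV[R]_n -> 'M[R]_n) (f : 'rV[R]_n -> R)
    (i j : 'I_n) (x : 'rV[R]_n) : R :=
  pd i (pd j f) x - \sum_(k < n) christoffel g k i j x * pd k f x.

(* E dx_1^2 + 2 F dx_1 dx_2 + G dx_2^2 *)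
Definition metric2 (R : realType) (E F G : 'rV[R]_2 -> R) (x : 'rV[R]_2) :
    'M[R]_2 :=
  \matrix_(i, j) if i != j then F x else if i == 0 then E x else G x.

Definition product_domain (R : realType) n (U : set 'rV[R]_n) (J : set R) :
    set 'rV[R]_(n + 1) :=
  [set x | U (lsubmx x) /\ J (rsubmx x 0 0)].

(* g + f^2 dt^2, where t is the last coordinate *)
Definition warped_metric (R : realType) n (g : 'rV[R]_n -> 'M[R]_n)
    (f : 'rV[R]_n -> R) (x : 'rV[R]_(n + 1)) : 'M[R]_(n + 1) :=
  block_mx (g (lsubmx x)) 0 0 ((f (lsubmx x) ^+ 2)%:M).

(* Main.v *)
(* Necessity. Since K <> 0, the Gauss equations R_12i3 = 0 force h_13 = h_23 = 0
   for the second fundamental form h of M in R^4; together with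
   h_ij h_33 = - f H_ij this gives (i). Moreover the unit vector phi_3 / f then
   has no derivative in the directions x_1 and x_2, so it depends on x_3 only,
   and so does its x_3-derivative phi_33 / f, whose square norm
   |grad f|^2 + (h_33 / f)^2 = |grad f|^2 + det H / (K Delta)
   depends only on (x_1, x_2): it is the constant c.

   Sufficiency. Condition (ii) is Darboux's equation: it says that the
   symmetric form g - df^2 / c is flat, and the strict inequality makes it
   positive definite. It is therefore locally dy_1^2 + dy_2^2, and
   (f cos(sqrt c x_3) / sqrt c, f sin(sqrt c x_3) / sqrt c, y_1, y_2)
   is a local isometric embedding. The coordinates y_i come from two uses of the
   Poincare lemma: the connection form of an orthonormal coframe is closed, and
   rotating the coframe by a primitive of it makes the coframe closed. *)

Require Import Defs.
From HB Require Import structures.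
From mathcomp Require Import all_boot all_order all_algebra.
From mathcomp Require Import all_classical all_reals all_analysis.
From mathcomp Require Import ring lra.
Import Order.TTheory GRing.Theory Num.Theory.
Import numFieldNormedType.Exports.
Set Implicit Arguments.
Unset Strict Implicit.
Unset Printing Implicit Defensive.
Local Open Scope classical_set_scope.
Local Open Scope ring_scope.

(** * Smooth functions *)

Section SmoothCalculus.
Context {R : realType} {n : nat}.
Implicit Types (U : set 'rV[R]_n) (f g : 'rV[R]_n -> R) (x : 'rV[R]_n) (i : 'I_n).

(** [smooth_on] speaks of iterated partial derivatives only, so chain rules are used along lines and
    all estimates come from the mean value theorem on coordinate segments.

    Curvature is computed with lowered Christoffel symbols for two reasons. For an isometric map
    they are the products of second with first derivatives, so the Gauss equation is an identity
    between full second derivatives of [phi], and the normal enters afterwards, chosen at one point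
    at a time. They are also linear in the metric, and those of df^2 are f_ij f_l, which makes the
    curvature of g - df^2 / c computable.

    The equations R_12i3 = 0 are a homogeneous linear system in h_13, h_23 with determinant -(h_11
    h_22 - h_12^2) = -K Delta; this is where K <> 0 acts. What is then integrated over U is phi_i3 =
    (f_i / f) phi_3.

    In the converse, with quad = Delta |grad f|^2, condition (ii) gives K^2 (c Delta - quad) = K det
    H > 0. This one inequality yields c > 0 and, as det (g - df^2 / c) = (c Delta - quad) / c, the
    positivity of the reduced metric. *)

Lemma open_near_eq U f g x : open U -> (forall y, U y -> f y = g y) -> U x ->
  \forall y \near x, f y = g y.
Proof. by move=> oU fg Ux; apply: filterS (open_nbhs_nbhs (conj oU Ux)). Qed.

Lemma derivable_eq_on U f g x v : open U -> (forall y, U y -> f y = g y) ->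
  U x -> derivable f x v -> derivable g x v.
Proof.
by move=> oU fg Ux; exact: (near_eq_derivable (open_near_eq oU fg Ux)).
Qed.

Lemma pd_eq_on U f g x i : open U -> (forall y, U y -> f y = g y) ->
  U x -> pd i f x = pd i g x.
Proof.
by move=> oU fg Ux; exact: (near_eq_derive _ (open_near_eq oU fg Ux)).
Qed.

Lemma continuous_eq_on U f g x : open U -> (forall y, U y -> f y = g y) ->
  U x -> {for x, continuous f} -> {for x, continuous g}.
Proof.
move=> oU fg Ux; rewrite /prop_for /continuous_at -(fg _ Ux).
apply: cvg_trans; exact: (near_eq_cvg (open_near_eq oU fg Ux)).
Qed.

(** A finite order supplies the induction behind the closure lemmas: the partial derivatives of a
    product, an inverse or a square root involve the same functions at one order less, whereas
    [smooth_on] quantifies over lists of indices. *)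
Fixpoint Ck k U f : Prop :=
  (forall x, U x -> {for x, continuous f}) /\
  if k is k'.+1 then
    (forall i x, U x -> derivable f x (delta_mx 0 i)) /\
    forall i, Ck k' U (pd i f)
  else True.

Lemma smooth_on_pd U f i : smooth_on U f -> smooth_on U (pd i f).
Proof. by move=> sf s; have := sf (rcons s i); rewrite /iter_pd foldr_rcons. Qed.

Lemma smooth_on_derivable U f x i :
  smooth_on U f -> U x -> derivable f x (delta_mx 0 i).
Proof. by move=> sf Ux; exact: (sf [::] x Ux).2. Qed.

Lemma smooth_on_continuous U f x :
  smooth_on U f -> U x -> {for x, continuous f}.
Proof. by move=> sf Ux; exact: (sf [::] x Ux).1. Qed.

Lemma smooth_onP U f : smooth_on U f <-> forall k, Ck k U f.
Proof.
split=> [sf k|cf s].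
  elim: k f sf => [|k IH] f sf /=; split => //.
  - by move=> x; exact: smooth_on_continuous.
  - by move=> x; exact: smooth_on_continuous.
  split=> [i x|i]; first exact: smooth_on_derivable.
  exact/IH/smooth_on_pd.
(* [iter_pd] applies the last index of the list first, so peeling it off replaces [f] by
   [pd i f]. *)
elim/last_ind: s f cf => [|s i IH] f cf x Ux.
  by have [cont [der _]] := cf 1%N; split=> [|i]; [exact: cont|exact: der].
rewrite /iter_pd foldr_rcons; apply: (IH _ _ x Ux) => k.
by have [_ [_ /(_ i)]] := cf k.+1.
Qed.

Lemma Ck_eq_on U f g k : open U -> (forall y, U y -> f y = g y) ->
  Ck k U f -> Ck k U g.
Proof.
move=> oU; elim: k f g => [|k IH] f g fg [cf df]; split => //.
- by move=> x Ux; exact: continuous_eq_on oU fg Ux (cf x Ux).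
- by move=> x Ux; exact: continuous_eq_on oU fg Ux (cf x Ux).
case: df => df pf; split=> [i x Ux|i].
  exact: derivable_eq_on oU fg Ux (df i x Ux).
by apply: IH (pf i) => y Uy; exact: pd_eq_on oU fg Uy.
Qed.

Lemma Ck_continuous U f k x : Ck k U f -> U x -> {for x, continuous f}.
Proof. by case: k => [|k] [cf _]; exact: cf. Qed.

Lemma CkW U f k : Ck k.+1 U f -> Ck k U f.
Proof.
elim: k f => [|k IH] f [cf [df pf]]; first by split.
by split=> //; split=> // i; exact/IH/pf.
Qed.

(** The formula [df] has to describe the partial derivatives on [U] only; openness of [U] passes the
    agreement on to all further derivatives. *)
Lemma CkS U f k (df : 'I_n -> 'rV[R]_n -> R) : open U ->
  (forall x, U x -> {for x, continuous f}) ->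
  (forall i x, U x -> is_derive x (delta_mx 0 i) f (df i x)) ->
  (forall i, Ck k U (df i)) -> Ck k.+1 U f.
Proof.
move=> oU cf fd Cd; split=> //; split=> [i x Ux|i]; first by have [] := fd i x Ux.
apply: Ck_eq_on (Cd i) => // y Uy.
by rewrite /pd; apply/esym; have [_ ->] := fd i y Uy.
Qed.

Lemma pd_is_derive U f k x i : Ck k.+1 U f -> U x ->
  is_derive x (delta_mx 0 i) f (pd i f x).
Proof. by move=> [_ [df _]] Ux; apply: derivableP; exact: df. Qed.

Lemma smooth_is_derive U f x i : smooth_on U f -> U x ->
  is_derive x (delta_mx 0 i) f (pd i f x).
Proof. by move=> sf Ux; apply: derivableP; exact: (smooth_on_derivable sf Ux). Qed.

Lemma pd_val f x i df : is_derive x (delta_mx 0 i) f df -> pd i f x = df.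
Proof. by case. Qed.

Lemma smooth_on_sub U V f : V `<=` U -> smooth_on U f -> smooth_on V f.
Proof. by move=> VU sf s x /VU Ux; exact: sf. Qed.

Lemma smooth_on_eq U f g : open U -> (forall y, U y -> f y = g y) ->
  smooth_on U f -> smooth_on U g.
Proof. by move=> oU fg /smooth_onP cf; apply/smooth_onP => k;
  exact: Ck_eq_on oU fg (cf k). Qed.

Lemma Ck_cst U k (c : R) : open U -> Ck k U (fun=> c).
Proof.
move=> oU; elim: k c => [|k IH] c; first by split=> // x _; exact: cst_continuous.
apply: (CkS (df := fun _ _ => 0)) => // x _; exact: cst_continuous.
Qed.

Lemma CkD U f g k : open U -> Ck k U f -> Ck k U g ->
  Ck k U (fun x => f x + g x).
Proof.
move=> oU; elim: k f g => [|k IH] f g Cf Cg.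
  by split=> // x Ux; apply: continuousD; [exact: (Ck_continuous Cf Ux)|exact:
    (Ck_continuous Cg Ux)].
apply: (CkS (df := fun i x => pd i f x + pd i g x)) => //.
- by move=> x Ux; apply: continuousD; [exact: (Ck_continuous Cf Ux)|exact:
  (Ck_continuous Cg Ux)].
- by move=> i x Ux; apply: is_deriveD; [exact: (pd_is_derive _ Cf Ux)|exact:
  (pd_is_derive _ Cg Ux)].
- by case: Cf Cg => _ [_ pf] [_ [_ pg]] i; exact: (IH _ _ (pf i) (pg i)).
Qed.

Lemma CkM U f g k : open U -> Ck k U f -> Ck k U g ->
  Ck k U (fun x => f x * g x).
Proof.
move=> oU; elim: k f g => [|k IH] f g Cf Cg.
  by split=> // x Ux; apply: continuousM; [exact: (Ck_continuous Cf Ux)|exact: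
    (Ck_continuous Cg Ux)].
apply: (CkS (df := fun i x => f x * pd i g x + g x * pd i f x)) => //.
- by move=> x Ux; apply: continuousM; [exact: (Ck_continuous Cf Ux)|exact:
  (Ck_continuous Cg Ux)].
- by move=> i x Ux; apply: is_deriveM; [exact: (pd_is_derive _ Cf Ux)|exact:
  (pd_is_derive _ Cg Ux)].
- case: (Cf) (Cg) => _ [_ pf] [_ [_ pg]] i.
  by apply: CkD => //; [exact: (IH _ _ (CkW Cf) (pg i))|exact: (IH _ _ (CkW Cg) (pf
    i))].
Qed.

Lemma is_deriveVf f x v df : f x != 0 -> is_derive x v f df ->
  is_derive x v (fun y => (f y)^-1) (- (f x) ^- 2 * df).
Proof.
move=> fx0 fd; apply: DeriveDef; first by apply: derivableV => //; have [] := fd.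
by rewrite deriveV //; have [_ ->] := fd.
Qed.

(** Only a directional derivative of [f] is given, so the one-variable chain rule is applied to the
    restriction of [f] to the line through [x] in the direction [v]. *)
Lemma is_derive_comp1 (h : R -> R) f x v df dh : is_derive (f x) 1 h dh ->
  is_derive x v f df -> is_derive x v (fun y => h (f y)) (dh * df).
Proof.
move=> hd fd.
pose u (t : R) := f (t *: v + x).
have u0 : u 0 = f x by rewrite /u scale0r add0r.
have du : derivable u 0 1 by have [/derivable1P] := fd.
have dh1 : derivable h (u 0) 1 by rewrite u0; have [] := hd.
have Dline (k : 'rV[R]_n -> R) : derive1 (fun t : R => k (t *: v + x)) 0 = 'D_v k x.
  rewrite derive1E /derive; set g1 := fun t => t^-1 *: _; set g2 := fun t => t^-1 *: _.
  suff -> : g1 = g2 by [].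
  by apply/funext => t; rewrite /g1 /g2 /= addr0 scale0r add0r [_%:A]mulr1.
have Du : derive1 u 0 = df by rewrite Dline; have [_ ->] := fd.
have dc : derivable (h \o u) 0 1.
  by apply/derivable1_diffP; apply: differentiable_comp; apply/derivable1_diffP.
apply: DeriveDef; first exact: ((derivable1P (fun y => h (f y)) x v).2 dc).
apply: etrans (esym (Dline (fun y => h (f y)))) _.
apply: etrans (derive1_comp du dh1) _.
by rewrite Du u0 derive1E; have [_ ->] := hd.
Qed.

Lemma CkV U f k : open U -> (forall x, U x -> f x != 0) ->
  Ck k U f -> Ck k U (fun x => (f x)^-1).
Proof.
move=> oU f0; elim: k => [|k IH] Cf.
  by split=> // x Ux; apply: continuousV; [exact: f0|exact: (Ck_continuous Cf Ux)].
have IHk := IH (CkW Cf).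
(* The derivative is written as a product of copies of the inverse itself, to which the induction
   hypothesis applies. *)
apply: (CkS (df := fun i x => (- 1 * ((f x)^-1 * (f x)^-1)) * pd i f x)) => //.
- by move=> x Ux; apply: continuousV; [exact: f0|exact: (Ck_continuous Cf Ux)].
- move=> i x Ux; rewrite mulN1r -invfM -expr2.
  by apply: is_deriveVf; [exact: f0|exact: (pd_is_derive _ Cf Ux)].
- move=> i; case: (Cf) => _ [_ /(_ i) pf].
  by apply: CkM => //; apply: CkM => //; [exact: Ck_cst|exact: CkM].
Qed.

Lemma Ck_sqrt U f k : open U -> (forall x, U x -> 0 < f x) ->
  Ck k U f -> Ck k U (fun x => Num.sqrt (f x)).
Proof.
move=> oU f0 Cf.
have csq x : U x -> {for x, continuous (fun x => Num.sqrt (f x))}.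
  move=> Ux; apply: (@continuous_comp _ _ _ f Num.sqrt).
    exact: (Ck_continuous Cf Ux).
  exact: sqrt_continuous.
elim: k Cf => [|k IH] Cf; first by split.
have IHk := IH (CkW Cf).
apply: (CkS (df := fun i x => (2 * Num.sqrt (f x))^-1 * pd i f x)) => //.
- move=> i x Ux; apply: is_derive_comp1; last exact: (pd_is_derive _ Cf Ux).
  by apply: is_derive1_sqrt; exact: f0.
- move=> i; case: (Cf) => _ [_ /(_ i) pf]; apply: CkM => //.
  apply: CkV => //; first by move=> x Ux; rewrite mulf_neq0 // gt_eqF // sqrtr_gt0 f0.
  by apply: CkM => //; exact: Ck_cst.
Qed.

(** Each of the two functions appears in the derivative of the other, so the induction carries
    both. *)
Lemma Ck_sin_cos U f k : open U -> Ck k U f ->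
  Ck k U (fun x => sin (f x)) /\ Ck k U (fun x => cos (f x)).
Proof.
move=> oU Cf.
have cs x : U x -> {for x, continuous (fun x => sin (f x))}.
  move=> Ux; apply: (@continuous_comp _ _ _ f sin); first exact: (Ck_continuous Cf Ux).
  exact: continuous_sin.
have cc x : U x -> {for x, continuous (fun x => cos (f x))}.
  move=> Ux; apply: (@continuous_comp _ _ _ f cos); first exact: (Ck_continuous Cf Ux).
  exact: continuous_cos.
elim: k Cf => [|k IH] Cf; first by do 2!split.
have [IHs IHc] := IH (CkW Cf); case: (Cf) => _ [_ pf]; split.
- apply: (CkS (df := fun i x => cos (f x) * pd i f x)) => //.
    by move=> i x Ux; apply: is_derive_comp1; exact: (pd_is_derive _ Cf Ux).
  by move=> i; exact: (CkM oU IHc (pf i)).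
- apply: (CkS (df := fun i x => - 1 * sin (f x) * pd i f x)) => //.
    move=> i x Ux; rewrite mulN1r.
    by apply: is_derive_comp1; exact: (pd_is_derive _ Cf Ux).
  by move=> i; apply: (CkM oU _ (pf i)); apply: CkM => //; exact: Ck_cst.
Qed.

Section Closure.
Context {U} (oU : open U).

Lemma smooth_cst (c : R) : smooth_on U (fun=> c).
Proof. by apply/smooth_onP => k; exact: Ck_cst. Qed.

Lemma smoothD f g : smooth_on U f -> smooth_on U g -> smooth_on U (fun x => f x + g x).
Proof. by move=> /smooth_onP Cf /smooth_onP Cg; apply/smooth_onP => k; exact: CkD. Qed.

Lemma smoothM f g : smooth_on U f -> smooth_on U g -> smooth_on U (fun x => f x * g x).
Proof. by move=> /smooth_onP Cf /smooth_onP Cg; apply/smooth_onP => k; exact: CkM. Qed.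

Lemma smoothN f : smooth_on U f -> smooth_on U (fun x => - f x).
Proof.
move=> sf; apply: (smooth_on_eq oU (f := fun x => -1 * f x)).
  by move=> y _; rewrite mulN1r.
exact: smoothM (smooth_cst _) sf.
Qed.

Lemma smoothB f g : smooth_on U f -> smooth_on U g -> smooth_on U (fun x => f x - g x).
Proof. by move=> sf sg; exact: smoothD sf (smoothN sg). Qed.

Lemma smoothX f k : smooth_on U f -> smooth_on U (fun x => f x ^+ k).
Proof.
move=> sf; elim: k => [|k IH]; first exact: smooth_cst.
by apply: (smooth_on_eq oU (f := fun x => f x * f x ^+ k)); [move=> y _;
  rewrite exprS|exact: smoothM].
Qed.

Lemma smoothV f : (forall x, U x -> f x != 0) -> smooth_on U f -> smooth_on U (fun x =>
  (f x)^-1).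
Proof. by move=> f0 /smooth_onP Cf; apply/smooth_onP => k; exact: CkV. Qed.

Lemma smooth_sqrt f : (forall x, U x -> 0 < f x) -> smooth_on U f ->
  smooth_on U (fun x => Num.sqrt (f x)).
Proof. by move=> f0 /smooth_onP Cf; apply/smooth_onP => k; exact: Ck_sqrt. Qed.

Lemma smooth_sin f : smooth_on U f -> smooth_on U (fun x => sin (f x)).
Proof. by move=> /smooth_onP Cf; apply/smooth_onP => k; have [] :=
  Ck_sin_cos oU (Cf k). Qed.

Lemma smooth_cos f : smooth_on U f -> smooth_on U (fun x => cos (f x)).
Proof. by move=> /smooth_onP Cf; apply/smooth_onP => k; have [] :=
  Ck_sin_cos oU (Cf k). Qed.

End Closure.

Lemma smooth_sum U m (h : 'I_m -> 'rV[R]_n -> R) : open U ->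
  (forall k, smooth_on U (h k)) -> smooth_on U (fun x => \sum_k h k x).
Proof.
move=> oU; elim: m h => [|m IH] h sh.
  apply: (smooth_on_eq oU (f := fun=> 0)); last exact: smooth_cst.
  by move=> y _; rewrite big_ord0.
apply: (smooth_on_eq oU (f := fun x => \sum_(k < m) h (widen_ord (leqnSn m) k) x + h
  ord_max x)).
  by move=> y _; rewrite big_ord_recr.
by apply: smoothD => //; exact: IH.
Qed.

Lemma is_derive_coord x v (k : 'I_n) :
  is_derive x v (fun y : 'rV[R]_n => y 0 k) (v 0 k).
Proof.
have did : derivable (id : 'rV[R]_n -> 'rV[R]_n) x v by exact: derivable_id.
apply: DeriveDef; first exact: (((derivable_mxP id x v).1 did) 0 k).
have /matrixP/(_ 0 k) := derive_mx did.
by rewrite derive_id [RHS]mxE => ->.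
Qed.

Lemma smooth_coord U (k : 'I_n) : open U -> smooth_on U (fun y => y 0 k).
Proof.
move=> oU; apply/smooth_onP => -[|m].
  by split=> // x _; exact: coord_continuous.
apply: (CkS (df := fun i _ => (delta_mx 0 i : 'rV[R]_n) 0 k)) => //.
- by move=> x _; exact: coord_continuous.
- by move=> i x _; exact: is_derive_coord.
- by move=> i; exact: Ck_cst.
Qed.

Lemma smooth_onS U f (df : 'I_n -> 'rV[R]_n -> R) : open U ->
  (forall x, U x -> {for x, continuous f}) ->
  (forall i x, U x -> is_derive x (delta_mx 0 i) f (df i x)) ->
  (forall i, smooth_on U (df i)) -> smooth_on U f.
Proof.
move=> oU cf fd sd; apply/smooth_onP => -[|k]; first by split.
by apply: (CkS oU cf fd) => i; have /smooth_onP := sd i.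
Qed.

End SmoothCalculus.

(** * Functions of the first block of coordinates *)

Section Lift.
Context {R : realType} {m n : nat}.
Implicit Types (U : set 'rV[R]_m) (u : 'rV[R]_m -> R).

Lemma lsubmx_shift (h : R) (v x : 'rV[R]_(m + n)) :
  lsubmx (h *: v + x) = h *: lsubmx v + lsubmx x.
Proof. by apply/rowP => j; rewrite !mxE. Qed.

(** The two difference quotients are the same function of the increment, because [lsubmx] is linear.
    A direction in the last block projects to 0, which covers the vanishing derivatives. *)
Lemma is_derive_lsubmx u (x v : 'rV[R]_(m + n)) df :
  is_derive (lsubmx x) (lsubmx v) u df ->
  is_derive x v (fun y => u (lsubmx y)) df.
Proof.
move=> [ud uD].
have E : (fun h : R => h^-1 *: (((fun y : 'rV[R]_(m + n) =>
  u (lsubmx y)) \o shift x) (h *: v) - u (lsubmx x)))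
  = (fun h : R => h^-1 *: ((u \o shift (lsubmx x)) (h *: lsubmx v) - u (lsubmx x))).
  by apply/funext => h /=; rewrite lsubmx_shift.
apply: DeriveDef; first by rewrite /derivable E.
by rewrite /derive E.
Qed.

Lemma lsubmx_delta_l (i : 'I_m) :
  lsubmx (delta_mx 0 (lshift n i) : 'rV[R]_(m + n)) = delta_mx 0 i.
Proof. by apply/rowP => j; rewrite !mxE eq_lshift. Qed.

Lemma lsubmx_delta_r (i : 'I_n) :
  lsubmx (delta_mx 0 (rshift m i) : 'rV[R]_(m + n)) = 0.
Proof. by apply/rowP => j; rewrite !mxE eq_lrshift andbF. Qed.

Lemma continuous_lsubmx : continuous (lsubmx : 'rV[R]_(m + n) -> 'rV[R]_m).
Proof. by move=> x; apply/differentiable_continuous/differentiable_lsubmx. Qed.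

Lemma smooth_lift U (V : set 'rV[R]_(m + n)) u : open V -> smooth_on U u ->
  (forall x : 'rV[R]_(m + n), V x -> U (lsubmx x)) ->
  smooth_on V (fun x => u (lsubmx x)).
Proof.
move=> oV su VU; apply/smooth_onP => k.
elim: k u su => [|k IH] u su.
  split=> // x Vx; apply: continuous_comp; first exact: continuous_lsubmx.
  exact: (smooth_on_continuous su (VU _ Vx)).
pose df (i : 'I_(m + n)) (x : 'rV[R]_(m + n)) : R :=
  match fintype.split i with inl j => pd j u (lsubmx x) | inr _ => 0 end.
apply: (@CkS R (m + n) V (fun x => u (lsubmx x)) k df) => //.
- move=> x Vx; apply: continuous_comp; first exact: continuous_lsubmx.
  exact: (smooth_on_continuous su (VU _ Vx)).
- move=> i x Vx; apply: is_derive_lsubmx.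
  rewrite /df; case: splitP => j ij.
    have -> : i = lshift n j by apply: val_inj.
    rewrite lsubmx_delta_l; exact: (smooth_is_derive j su (VU _ Vx)).
  have -> : i = rshift m j by apply: val_inj.
  by rewrite lsubmx_delta_r; exact: is_derive0.
- move=> i; rewrite /df; case: (fintype.split i) => j; last exact: Ck_cst.
  by apply: IH; exact: smooth_on_pd.
Qed.

Lemma pd_lift_l u (i : 'I_m) (x : 'rV[R]_(m + n)) :
  pd (lshift n i) (fun y => u (lsubmx y)) x = pd i u (lsubmx x).
Proof.
rewrite /pd /derive.
set g1 := fun t => t^-1 *: _; set g2 := fun t => t^-1 *: _.
suff -> : g1 = g2 by [].
by apply/funext => t; rewrite /g1 /g2 /= lsubmx_shift lsubmx_delta_l.
Qed.

Lemma pd_lift_r u (i : 'I_n) (x : 'rV[R]_(m + n)) :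
  pd (rshift m i) (fun y => u (lsubmx y)) x = 0.
Proof.
have : is_derive x (delta_mx 0 (rshift m i)) (fun y => u (lsubmx y)) 0.
  by apply: is_derive_lsubmx; rewrite lsubmx_delta_r; exact: is_derive0.
by case.
Qed.

End Lift.

(** * Mean value estimates *)

Section Box.
Context {R : realType} {n : nat}.
Implicit Types (U : set 'rV[R]_n) (u : 'rV[R]_n -> R) (x y p v : 'rV[R]_n) (i : 'I_n).

Lemma ball_rowP p (r : R) x : 0 < r ->
  ball p r x <-> forall k, `|p 0 k - x 0 k| < r.
Proof.
move=> r0; split=> [[_ px] k|px]; first exact: px.
by split=> // i k; rewrite ord1; exact: px.
Qed.

Lemma open_ball_sub U p : open U -> U p ->
  exists2 r : R, 0 < r & ball p r `<=` U.
Proof.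
move=> oU Up; have /nbhs_ballP[r /= r0 rU] := open_nbhs_nbhs (conj oU Up).
by exists r.
Qed.

Lemma ball_segment p (r : R) x i (h s : R) : 0 <= s <= 1 ->
  ball p r x -> ball p r (x + h *: delta_mx 0 i) ->
  ball p r (x + (s * h) *: delta_mx 0 i).
Proof.
move=> s01 [r0 px] [_ py]; split=> // a k; have := px a k; have := py a k.
rewrite /ball /= !mxE; case: (_ && _); rewrite ?mulr1 ?mulr0 ?addr0 //.
rewrite !ltr_norml => /andP[h1 h2] /andP[h3 h4]; case/andP: s01 => s0 s1.
have -> : p a k - (x a k + s * h) =
  (1 - s) * (p a k - x a k) + s * (p a k - (x a k + h)) by ring.
by case: (lerP (p a k - x a k) (p a k - (x a k + h))) => AB; apply/andP; split; nra.
Qed.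

Lemma is_derive_line u x v (t df : R) : is_derive (x + t *: v) v u df ->
  is_derive t 1 (fun s : R => u (x + s *: v)) df.
Proof.
move=> [ud uD].
have E : (fun h : R => h^-1 *: (((fun s : R =>
  u (x + s *: v)) \o shift t) (h *: 1) - u (x + t *: v)))
  = (fun h : R => h^-1 *: ((u \o shift (x + t *: v)) (h *: v) - u (x + t *: v))).
  by apply/funext => h /=; rewrite [_%:A]mulr1 scalerDl addrCA.
apply: DeriveDef; first by rewrite /derivable E.
by rewrite /derive E.
Qed.

Lemma is_derive_translate u y w v (df : R) : is_derive (y + w) v u df ->
  is_derive y v (fun z => u (z + w)) df.
Proof.
move=> [ud uD].
have E : (fun h : R => h^-1 *: (((fun z => u (z + w)) \o shift y) (h *: v) - u (y + w)))
  = (fun h : R => h^-1 *: ((u \o shift (y + w)) (h *: v) - u (y + w))).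
  by apply/funext => h /=; rewrite addrA.
apply: DeriveDef; first by rewrite /derivable E.
by rewrite /derive E.
Qed.

Lemma mvt_coord u x i (h : R) :
  (forall s : R, 0 <= s <= 1 ->
     derivable u (x + (s * h) *: delta_mx 0 i) (delta_mx 0 i)) ->
  exists2 s : R, 0 <= s <= 1 &
    u (x + h *: delta_mx 0 i) - u x = h * pd i u (x + (s * h) *: delta_mx 0 i).
Proof.
move=> du.
pose phi (s : R) := u (x + (s * h) *: delta_mx 0 i).
have dphi (s : R) : 0 <= s <= 1 ->
  is_derive s 1 phi (pd i u (x + (s * h) *: delta_mx 0 i) * h).
  move=> s01.
  apply: (@is_derive1_comp R (fun t : R => u (x + t *: delta_mx 0 i)) (fun s => s * h)).
    by apply: is_derive_line; apply: derivableP; exact: du.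
  have -> : (fun s : R => s * h) = h \*: id.
    by apply/funext => z /=; rewrite mulrC.
  by apply: is_derive_eq; rewrite [LHS]mulr1.
have cphi : {within `[0, 1], continuous phi}.
  apply: derivable_within_continuous => s; rewrite in_itv /= => s01.
  by have [] := dphi s s01.
have dphi' (s : R) : s \in `]0, 1[ ->
    is_derive s 1 phi (pd i u (x + (s * h) *: delta_mx 0 i) * h).
  by move=> s01; apply: dphi; rewrite !ltW ?(itvP s01).
have [c c01] := MVT_segment ler01 dphi' cphi.
rewrite /phi mul1r mul0r scale0r addr0 subr0 mulr1 mulrC => ->.
by exists c => //; move: c01; rewrite in_itv.
Qed.

(** Vertices of the staircase path from [y] to [x] that changes one coordinate at a time. Balls of
    row vectors are cubes, so the path stays in any ball containing its ends. *)
Definition hybrid x y (k : nat) : 'rV[R]_n := \row_j if (j < k)%N then x 0 j else y 0 j.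

Lemma hybridS x y (k : 'I_n) :
  hybrid x y k.+1 = hybrid x y k + (x 0 k - y 0 k) *: delta_mx 0 k.
Proof.
apply/rowP => j; rewrite !mxE eqxx /= ltnS.
have [->|jk] := eqVneq j k; first by rewrite leqnn ltnn mulr1; ring.
by rewrite mulr0 addr0 leq_eqVlt (negbTE (_ : val j != val k)) //.
Qed.

Lemma ball_hybrid p (r : R) x y k : ball p r x -> ball p r y ->
  ball p r (hybrid x y k).
Proof.
move=> [r0 px] [_ py]; split=> // a j; rewrite (ord1 a) mxE.
by case: ifP => _; [exact: px|exact: py].
Qed.

Lemma lipschitz_ball u p (r C d : R) x y :
  (forall i z, ball p r z -> derivable u z (delta_mx 0 i)) ->
  (forall i z, ball p r z -> `|pd i u z| <= C) ->
  ball p r x -> ball p r y -> (forall k, `|x 0 k - y 0 k| <= d) ->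
  `|u x - u y| <= n%:R * (C * d).
Proof.
move=> du uC px py xyd.
suff H k : (k <= n)%N -> `|u (hybrid x y k) - u y| <= k%:R * (C * d).
  by have := H n (leqnn n); rewrite (_ : hybrid x y n = x) //; apply/rowP => j;
    rewrite mxE ltn_ord.
elim: k => [_|k IH kn].
  rewrite (_ : hybrid x y 0 = y) ?subrr ?normr0 ?mul0r //.
  by apply/rowP => j; rewrite mxE.
have := hybridS x y (Ordinal kn); rewrite /= => E.
have bk : ball p r (hybrid x y k) by exact: ball_hybrid.
have bk1 : ball p r (hybrid x y k.+1) by exact: ball_hybrid.
rewrite E in bk1.
have [|s s01 mv] := @mvt_coord u (hybrid x y k) (Ordinal kn) (x 0 (Ordinal kn) - y 0
  (Ordinal kn)).
  by move=> s s01; apply: du; exact: ball_segment.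
rewrite E -(subrK (u (hybrid x y k)) (u (_ + _))) mv -addrA.
apply: (le_trans (ler_normD _ _)).
rewrite -natr1 [in leRHS]mulrDl mul1r [leRHS]addrC lerD ?IH ?(ltnW kn) //.
rewrite normrM mulrC; apply: ler_pM => //; apply: uC; exact: ball_segment.
Qed.

Lemma ball_pd0_const u p (r : R) x y :
  (forall i z, ball p r z -> is_derive z (delta_mx 0 i) u 0) ->
  ball p r x -> ball p r y -> u x = u y.
Proof.
move=> du px py; apply/eqP; rewrite -subr_eq0 -normr_le0.
have r0 : 0 < r by case: px.
(* The Lipschitz constant is 0, so any bound on the coordinates of [x - y] will do; the diameter of
   the ball is one. *)
have := @lipschitz_ball u p r 0 (r *+ 2) x y; rewrite mul0r mulr0; apply => //.
- by move=> i z pz; have [] := du i z pz.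
- by move=> i z pz; have [_] := du i z pz; rewrite /pd => ->; rewrite normr0.
- move=> k; case: px py => _ /(_ 0 k) px [_ /(_ 0 k) py].
  rewrite -(subrK (p 0 k) (x 0 k)) -addrA (le_trans (ler_normD _ _))//.
  by rewrite mulr2n lerD // ltW // distrC.
Qed.

(** Continuous partial derivatives are bounded near [x], so [u] is Lipschitz there. *)
Lemma continuous_of_pd U u : open U ->
  (forall i x, U x -> derivable u x (delta_mx 0 i)) ->
  (forall i x, U x -> {for x, continuous (pd i u)}) ->
  forall x, U x -> {for x, continuous u}.
Proof.
move=> oU du cdu x Ux.
have [r r0 rU] := open_ball_sub oU Ux.
have nb : \forall z \near x, forall i, `|pd i u z - pd i u x| < 1.
  apply: (@filter_forall _ _ (fun i z => `|pd i u z - pd i u x| < 1) (nbhs x)) => i.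
  have /cvgrPdist_lt/(_ 1 ltr01) := cdu i x Ux.
  by apply: filterS => z; rewrite distrC.
have /nbhs_ballP[r1 /= r10 r1n] := nb.
(* The summand 1 bounds the variation of the partial derivatives near [x] and keeps [C] positive. *)
pose C := 1 + \sum_i `|pd i u x|.
pose r2 := Num.min r r1.
have r20 : 0 < r2 by rewrite lt_min r0.
have sub1 z : ball x r2 z -> ball x r z by apply: le_ball; rewrite ge_min lexx.
have sub2 z : ball x r2 z -> ball x r1 z by apply: le_ball; rewrite ge_min lexx orbT.
have Cb i z : ball x r2 z -> `|pd i u z| <= C.
  move=> /sub2/r1n/(_ i)/ltW h; rewrite -(subrK (pd i u x) (pd i u z)).
  rewrite (le_trans (ler_normD _ _))// lerD //.
  by rewrite (bigD1 i) //= lerDl sumr_ge0.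
have C0 : 0 < C by rewrite ltr_pwDl // sumr_ge0.
apply/(@cvgrPdist_lt _ _ _ (nbhs x) (nbhs_filter x) u) => e e0.
(* [n.+1] instead of [n] keeps the denominator positive for [n] = 0 and makes the final estimate
   strict. *)
pose dl := Num.min r2 (e / (n.+1%:R * C)).
have dl0 : 0 < dl by rewrite lt_min r20 divr_gt0 // mulr_gt0.
apply/nbhs_ballP; exists dl => //= z xz.
have xz2 : ball x r2 z by apply: le_ball xz; rewrite ge_min lexx.
apply: (@le_lt_trans _ _ (n%:R * (C * dl))).
  apply: (lipschitz_ball (p := x) (r := r2)) => //.
  - by move=> i y /sub1/rU; exact: du.
  - exact: ballxx.
  - by move=> k; case: xz => _ /(_ 0 k) /ltW.
apply: (@lt_le_trans _ _ (n.+1%:R * (C * dl))).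
  by rewrite ltr_pM2r ?mulr_gt0 // ltr_nat.
by rewrite mulrA mulrC -ler_pdivlMr ?mulr_gt0 // ge_min lexx orbT.
Qed.

Lemma smooth_of_pd U u (df : 'I_n -> 'rV[R]_n -> R) : open U ->
  (forall i x, U x -> is_derive x (delta_mx 0 i) u (df i x)) ->
  (forall i, smooth_on U (df i)) -> smooth_on U u.
Proof.
move=> oU fd sd; apply: (smooth_onS (df := df)) => //.
apply: continuous_of_pd => // i x Ux; first by have [] := fd i x Ux.
apply: (continuous_eq_on oU (f := df i)) => //.
  by move=> y Uy; have [_ <-] := fd i y Uy.
exact: smooth_on_continuous (sd i) Ux.
Qed.

(** By the mean value estimate [u] is locally constant, so every condition on its value defines an
    open subset of [U]. On the image of a path, which is connected, the level set through [x] is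
    therefore relatively open and closed. *)
Lemma path_connected_pd0_const U u : open U -> path_connected R U ->
  (forall i z, U z -> is_derive z (delta_mx 0 i) u 0) ->
  forall x y, U x -> U y -> u x = u y.
Proof.
move=> oU [_ pc] du x y Ux Uy; have [gam [cg gU g0 g1]] := pc x y Ux Uy.
pose C := gam @` `[0, 1].
have cC : connected C.
  by apply: connected_continuous_connected => //; exact: segment_connected.
have loc z : U z -> exists2 r : R, 0 < r & forall w, ball z r w -> U w /\ u w = u z.
  move=> Uz; have [r r0 rU] := open_ball_sub oU Uz.
  exists r => // w zw; split; first exact: rU.
  apply: (@ball_pd0_const u z r) => //; last exact: ballxx.
  by move=> i v /rU; exact: du.
have oP (P : set R) : open [set z | U z /\ P (u z)].
  rewrite openE => z [Uz uz]; have [r r0 rb] := loc z Uz.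
  apply/nbhs_ballP; exists r => //= w /rb[Uw uw]; split => //.
  by rewrite uw.
have CE : C `&` [set z | u z = u x] = C.
  apply: cC.
  - by exists x; split=> //; exists 0 => //=; rewrite in_itv /= lexx ler01.
  - exists [set z | U z /\ u z = u x]; first exact: (oP [set t | t = u x]).
    by apply/seteqP; split=> z [Cz]; [move=> uz; split=> //; split=> //;
      exact: gU|case].
  - exists (~` [set z | U z /\ u z <> u x]).
      exact: open_closedC (oP [set t | t <> u x]).
    apply/seteqP; split=> z [Cz] /= uz; split=> //; first by case.
    by apply: contrapT => nu; apply: uz; split=> //; exact: gU.
have : C y by exists 1 => //=; rewrite in_itv /= lexx ler01.
by rewrite -CE => -[_].
Qed.

Lemma ball_add2 x i j (a b h r : R) : `|a| <= h -> `|b| <= h -> h *+ 2 < r ->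
  ball x r (x + a *: delta_mx 0 i + b *: delta_mx 0 j).
Proof.
move=> ah bh hr; have h0 : 0 <= h by rewrite (le_trans _ ah).
apply/ball_rowP => [|k]; first by rewrite (le_lt_trans _ hr) // mulrn_wge0.
rewrite (le_lt_trans _ hr) // !mxE !eqxx -addrA opprD addrA subrr add0r normrN.
rewrite (le_trans (ler_normD _ _)) // mulr2n lerD // normrM.
  by rewrite -[leRHS]mulr1 ler_pM //= normr_nat lern1 leq_b1.
by rewrite -[leRHS]mulr1 ler_pM //= normr_nat lern1 leq_b1.
Qed.

(** Two mean values: one in the direction i for the difference of [u] and its translate, one in the
    direction j for [pd i u]. The left side is symmetric in i and j, which is what the symmetry of
    mixed derivatives rests on. *)
Lemma second_difference U u x i j (h r : R) : smooth_on U u -> ball x r `<=` U ->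
  0 < h -> h *+ 2 < r -> exists2 y, ball x r y &
  u (x + h *: delta_mx 0 i + h *: delta_mx 0 j) - u (x + h *: delta_mx 0 i) -
  (u (x + h *: delta_mx 0 j) - u x) = h * (h * pd j (pd i u) y).
Proof.
move=> su rU h0 hr.
have ball2 s t : 0 <= s <= 1 -> 0 <= t <= 1 ->
    ball x r (x + (s * h) *: delta_mx 0 i + (t * h) *: delta_mx 0 j).
  move=> /andP[s0 s1] /andP[t0 t1]; apply: (@ball_add2 _ _ _ _ _ h) => //.
    by rewrite ger0_norm ?mulr_ge0 ?(ltW h0) // ler_piMl // ltW.
  by rewrite ger0_norm ?mulr_ge0 ?(ltW h0) // ler_piMl // ltW.
have ball1 s : 0 <= s <= 1 -> ball x r (x + (s * h) *: delta_mx 0 i).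
  by move=> s01; have := ball2 s 0 s01; rewrite mul0r scale0r addr0; apply;
    rewrite lexx ler01.
pose w : 'rV[R]_n := h *: delta_mx 0 j.
have ball3 s : 0 <= s <= 1 -> ball x r (x + (s * h) *: delta_mx 0 i + w).
  by move=> s01; have := ball2 s 1 s01; rewrite mul1r; apply; rewrite ler01 lexx.
have dpsi s : 0 <= s <= 1 ->
    is_derive (x + (s * h) *: delta_mx 0 i) (delta_mx 0 i) (fun z => u (z + w) - u z)
      (pd i u (x + (s * h) *: delta_mx 0 i + w) - pd i u (x + (s * h) *: delta_mx 0 i)).
  move=> s01; apply: is_deriveB.
    by apply: is_derive_translate; exact: (smooth_is_derive i su (rU _ (ball3 s s01))).
  exact: (smooth_is_derive i su (rU _ (ball1 s s01))).
have [|s s01 mv] := @mvt_coord (fun z => u (z + w) - u z) x i h.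
  by move=> s s01; have [] := dpsi s s01.
rewrite mv (pd_val (dpsi s s01)).
have [|t t01 mv2] := @mvt_coord (pd i u) (x + (s * h) *: delta_mx 0 i) j h.
  by move=> t t01; apply: (smooth_on_derivable (smooth_on_pd i su)); apply: rU;
    exact: ball2.
by rewrite mv2; exists (x + (s * h) *: delta_mx 0 i + (t * h) *: delta_mx 0 j);
  first exact: ball2.
Qed.

Lemma dist_half (a b d e : R) : `|b - a| < e / 2 -> `|d - a| < e / 2 -> `|b - d| <= e.
Proof.
move=> ba da; rewrite (le_trans (ler_distD a _ _)) // [leRHS]splitr (distrC a).
by rewrite lerD // ltW.
Qed.

(** Both mixed derivatives, each taken at some point near [x], equal the same second difference
    divided by h^2; their continuity at [x] does the rest. *)
Lemma schwarz U u x i j : open U -> smooth_on U u -> U x ->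
  pd i (pd j u) x = pd j (pd i u) x.
Proof.
move=> oU su Ux.
have [r r0 rU] := open_ball_sub oU Ux.
apply/eqP; rewrite -subr_eq0 -normr_le0; apply/ler_addgt0Pr => e e0; rewrite add0r.
have cont a b : \forall z \near x, `|pd a (pd b u) x - pd a (pd b u) z| < e / 2.
  have := smooth_on_continuous (smooth_on_pd a (smooth_on_pd b su)) Ux.
  by move/cvgrPdist_lt; apply; rewrite divr_gt0.
have /nbhs_ballP[r1 /= r10 r1c] : \forall z \near x,
    `|pd i (pd j u) x - pd i (pd j u) z| < e / 2 /\
    `|pd j (pd i u) x - pd j (pd i u) z| < e / 2.
  by apply: filterI; exact: cont.
pose r2 := Num.min r r1.
have r20 : 0 < r2 by rewrite lt_min r0.
have sub1 : ball x r2 `<=` U by move=> z xz; apply: rU; apply: le_ball xz;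
  rewrite ge_min lexx.
have sub2 z : ball x r2 z -> ball x r1 z by apply: le_ball; rewrite ge_min lexx orbT.
(* Twice [h] must stay below [r2]: for i = j both increments fall on the same coordinate. *)
pose h := r2 / 3.
have h0 : 0 < h by rewrite divr_gt0.
have h2 : h *+ 2 < r2 by rewrite /h; lra.
have [y1 b1 e1] := second_difference i j su sub1 h0 h2.
have [y2 b2 e2] := second_difference j i su sub1 h0 h2.
have E : pd j (pd i u) y1 = pd i (pd j u) y2.
  apply: (mulfI (lt0r_neq0 h0)); apply: (mulfI (lt0r_neq0 h0)).
  apply: etrans (esym e1) _; apply: etrans _ e2.
  rewrite (_ : x + h *: delta_mx 0 j + h *: delta_mx 0 i =
               x + h *: delta_mx 0 i + h *: delta_mx 0 j); last by rewrite addrAC.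
  by ring.
have [] := r1c _ (sub2 _ b1); have [] := r1c _ (sub2 _ b2).
rewrite E; move: (pd i (pd j u) y2) (pd i (pd j u) x) (pd j (pd i u) x) =>
  A B D c1 _ _ c2.
exact: (dist_half c1 c2).
Qed.

End Box.

(** * Immersions are locally embeddings *)

Section LocalEmbedding.
Context {R : realType} {n m : nat}.

Lemma norm_coord_le k (x : 'rV[R]_k) j : `|x 0 j| <= `|x|.
Proof.
rewrite [leRHS]/Num.norm /= mx_normrE.
by apply/bigmax_geP; right; exists (0, j).
Qed.

Lemma norm_row_le k (x : 'rV[R]_k) (d : R) : 0 <= d ->
  (forall j, `|x 0 j| <= d) -> `|x| <= d.
Proof.
move=> d0 xd; rewrite [leLHS]/Num.norm /= mx_normrE bigmax_le // => -[i j] _ /=.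
by rewrite ord1.
Qed.

(* With B a right inverse of the Jacobian at p, phi B - id has small partial
   derivatives near p, so phi is bi-Lipschitz there. *)
Lemma local_embedding (U : set 'rV[R]_n) (phi : 'rV[R]_n -> 'rV[R]_m) p :
  open U -> smooth_map_on U phi -> (forall x, U x -> row_free (jac phi x)) ->
  U p -> exists r : R, [/\ 0 < r, ball p r `<=` U & smooth_embedding (ball p r) phi].
Proof.
move=> oU sphi fr Up.
have /row_freeP[B JB] := fr p Up.
pose w (k : 'I_n) (x : 'rV[R]_n) : R := \sum_l phi x 0 l * B l k - x 0 k.
have sw k : smooth_on U (w k).
  apply: smoothB => //; last exact: smooth_coord.
  by apply: (smooth_sum oU) => l; exact: (smoothM oU (sphi l) (smooth_cst oU _)).
have dw k i : pd i (w k) p = 0.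
  apply: pd_val.
  have -> : 0 = \sum_l (jac phi p i l * B l k) - (delta_mx 0 i : 'rV[R]_n) 0 k.
    have /matrixP/(_ i k) := JB; rewrite !mxE => ->.
    by rewrite eqxx eq_sym /= subrr.
  apply: is_deriveB; last exact: is_derive_coord.
  rewrite (_ : (fun x : 'rV[R]_n => _) = \sum_l (fun x => phi x 0 l * B l k));
    last first.
    by apply/funext => x; rewrite fct_sumE.
  apply: is_derive_sum => l.
  have := smooth_is_derive i (sphi l) Up => dphi.
  rewrite mxE mulrC; have := is_deriveZ (B l k) dphi.
  by congr is_derive; apply/funext => x; rewrite mulrC.
(* With this bound on the derivatives of [w] its Lipschitz constant is at most n e <= 1/2, so [w]
   accounts for at most half of [x - y]. *)
pose e : R := (n.+1%:R *+ 2)^-1.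
have e0 : 0 < e by rewrite invr_gt0 mulrn_wgt0.
have near_w : \forall x \near p, forall ki : 'I_n * 'I_n, `|pd ki.2 (w ki.1) x| < e.
  apply: (@filter_forall _ _ (fun ki x => `|pd ki.2 (w ki.1) x| < e) (nbhs p)) =>
    -[k i] /=.
  have := smooth_on_continuous (smooth_on_pd i (sw k)) Up.
  move/cvgrPdist_lt => /(_ e e0); apply: filterS => x.
  by rewrite dw sub0r normrN.
have [r1 r10 r1U] := open_ball_sub oU Up.
have /nbhs_ballP[r2 /= r20 r2w] := near_w.
pose r := Num.min r1 r2.
have r0 : 0 < r by rewrite lt_min r10.
have rU : ball p r `<=` U.
  by move=> x px; apply: r1U; apply: le_ball px; rewrite ge_min lexx.
have rw x : ball p r x -> forall k i, `|pd i (w k) x| <= e.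
  move=> px k i; apply: ltW; apply: (r2w x _ (k, i)).
  by apply: le_ball px; rewrite ge_min lexx orbT.
have lip x y : ball p r x -> ball p r y ->
    `|x - y| <= `|phi x *m B - phi y *m B| *+ 2.
  move=> px py.
  have H : `|x - y| <= `|phi x *m B - phi y *m B| + `|x - y| / 2.
    apply: norm_row_le => [|k]; first by rewrite addr_ge0 // divr_ge0.
    have hw : `|w k x - w k y| <= n%:R * (e * `|x - y|).
      apply: (lipschitz_ball (p := p) (r := r)) => //.
      - by move=> i z /rU Uz; exact: smooth_on_derivable (sw k) Uz.
      - by move=> i z pz; exact: rw.
      - by move=> j; have := norm_coord_le (x - y) j; rewrite !mxE.
    have ne : n%:R * (e * `|x - y|) <= `|x - y| / 2.
      rewrite mulrA [leRHS]mulrC ler_wpM2r // /e -(mulr_natr n.+1%:R 2) invfM mulrA.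
      by rewrite ler_piMl ?invr_ge0 // ler_pdivrMr ?ltr0n // mul1r ler_nat.
    have E : (x - y) 0 k = (phi x *m B - phi y *m B) 0 k - (w k x - w k y).
      by rewrite /w !mxE; ring.
    rewrite E (le_trans (ler_normB _ _)) // lerD ?norm_coord_le //.
    exact: le_trans hw ne.
  by rewrite [leRHS]mulr2n; move: H; move: `|x - y| `|phi x *m B - phi y *m B| =>
    a b H; lra.
(* A preimage is chosen on the image of the ball, with default value [p] elsewhere; [lip] makes it
   unique there and the resulting inverse continuous. *)
pose psi (z : 'rV[R]_m) : 'rV[R]_n :=
  xget p [set x | ball p r x /\ phi x = z].
have psiK x : ball p r x -> psi (phi x) = x.
  move=> px; rewrite /psi; case: xgetP => [y _ [py yx]|/(_ x) []//].
  apply/eqP; rewrite -subr_eq0 -normr_le0.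
  by rewrite (le_trans (lip _ _ py px)) // yx subrr normr0 mul0rn.
exists r; split => //; split.
- by move=> k; apply: smooth_on_sub (sphi k).
- by move=> x /rU; exact: fr.
- exists psi; split => //.
  apply/subspace_continuousP => z [x px <-].
  rewrite -[X in _ --> X]/(psi (phi x)) psiK //; apply/cvgrPdist_lt => d d0.
  have nB : \forall z' \near phi x, forall k, `|(phi x *m B - z' *m B) 0 k| < d / 3.
    apply: (@filter_forall _ _ (fun k z' => `|(phi x *m B - z' *m B) 0 k| < d / 3)
      (nbhs (phi x))) => k.
    have sB : smooth_on setT (fun z' : 'rV[R]_m => \sum_l z' 0 l * B l k).
      apply: (smooth_sum openT) => l.
      by apply: (smoothM openT); [apply: smooth_coord;
        exact: openT|exact: (smooth_cst openT)].
    have d3 : 0 < d / 3 by rewrite divr_gt0.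
    have /cvgrPdist_lt/(_ _ d3) := smooth_on_continuous sB (I : setT (phi x)).
    by apply: filterS => z'; rewrite !mxE.
  rewrite near_withinE; near=> z' => -[y py yz'].
  have pz' : psi z' = y by rewrite -yz' psiK.
  apply: (@le_lt_trans _ _ `|x - y|); first by rewrite -pz'.
  rewrite (le_lt_trans (lip _ _ px py)) // yz'.
  have : `|phi x *m B - z' *m B| <= d / 3.
    apply: norm_row_le => [|k]; first by rewrite divr_ge0 // ltW.
    by apply: ltW; move: k; near: z'.
  by rewrite [ltLHS]mulr2n; move: `|_ - _| => a H; lra.
Unshelve. all: by end_near. Qed.

End LocalEmbedding.

(** * The Poincare lemma in the plane *)

Section PoincareLemma.
Context {R : realType}.
Local Notation mu := (@lebesgue_measure R).

Lemma within_continuous_for (h : R -> R) (a b : R) :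
  (forall t, a <= t <= b -> {for t, continuous h}) -> {within `[a, b], continuous h}.
Proof.
move=> ch; apply: continuous_in_subspaceT => t.
by rewrite inE /= in_itv /=; exact: ch.
Qed.

Lemma integrable_for (h : R -> R) (a b : R) :
  (forall t, a <= t <= b -> {for t, continuous h}) ->
  mu.-integrable `[a, b] (EFin \o h).
Proof.
move=> ch; apply: continuous_compact_integrable; first exact: segment_compact.
exact: within_continuous_for.
Qed.

Lemma is_derive_integral (h : R -> R) (a x b : R) : a < x < b ->
  (forall t, a <= t <= b -> {for t, continuous h}) ->
  is_derive x 1 (fun y => \int[mu]_(t in `[a, y]) h t) (h x).
Proof.
move=> /andP[ax xb] ch.
have [|dF Fx] := @continuous_FTC1_closed R h a x b xb (integrable_for ch) ax.
  by apply: ch; rewrite !ltW.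
by apply: DeriveDef; [exact: dF|rewrite -derive1E; exact: Fx].
Qed.

Lemma integral_is_derive (h H : R -> R) (a b : R) : a < b ->
  (forall t, a <= t <= b -> {for t, continuous h}) ->
  (forall t, a <= t <= b -> is_derive t 1 H (h t)) ->
  \int[mu]_(t in `[a, b]) h t = H b - H a.
Proof.
move=> ab ch dH.
have cH t : a <= t <= b -> {for t, continuous H}.
  by move=> tab; apply/differentiable_continuous/derivable1_diffP; have [] := dH t tab.
rewrite /Rintegral (@continuous_FTC2 R h H a b ab (within_continuous_for ch)) //.
- split.
  + by move=> t tab; have [|] := dH t; rewrite // !ltW ?(itvP tab).
  + by apply/cvg_at_right_filter; apply: cH; rewrite lexx ltW.
  + by apply/cvg_at_left_filter; apply: cH; rewrite lexx ltW.
- by move=> t tab; rewrite derive1E; have [|_ ->] := dH t; rewrite // !ltW ?(itvP tab).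
Qed.

Lemma is_derive_under_integral (h dh : R -> R -> R) (u v x a b C : R) : u < x < v ->
  (forall s t, u < s < v -> a <= t <= b -> {for t, continuous (h s)}) ->
  (forall s t, u < s < v -> a <= t <= b -> is_derive s 1 (h^~ t) (dh s t)) ->
  (forall s t, u < s < v -> a <= t <= b -> `|dh s t| <= C) ->
  is_derive x 1 (fun s => \int[mu]_(t in `[a, b]) h s t)
    (\int[mu]_(t in `[a, b]) dh x t).
Proof.
move=> xuv ch dhd dhC.
pose D := partial1of2 h.
have DE s t : u < s < v -> a <= t <= b -> D s t = dh s t.
  by move=> su ta; rewrite /D partial1of2E; have [_ ->] := dhd s t su ta.
have xI : `]u, v[%classic x by rewrite /= in_itv.
have intf s : `]u, v[%classic s -> mu.-integrable `[a, b] (EFin \o h s).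
  by rewrite /= in_itv /= => su; apply: integrable_for => t; exact: ch.
have der s t : `]u, v[%classic s -> `[a, b]%classic t -> derivable (h^~ t) s 1.
  by rewrite /= !in_itv /= => su ta; have [] := dhd s t su ta.
(* The dominating function is [|C|] rather than [C], since [C] may be negative when the interval is
   empty. *)
have G0 (t : R) : 0 <= (cst `|C| : R -> R) t by [].
have intG : mu.-integrable `[a, b] (EFin \o (cst `|C| : R -> R)).
  by apply: integrable_for => t _; exact: cst_continuous.
have Gub s t : `]u, v[%classic s -> `[a, b]%classic t -> `|D s t| <= (cst `|C| : R ->
  R) t.
  rewrite /= !in_itv /= => su ta; rewrite DE //.
  exact: le_trans (dhC s t su ta) (ler_norm _).
have mI : measurable `[a, b]%classic by exact: measurable_itv.
apply: DeriveDef.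
  exact: (@derivable_under_integral R _ _ mu h _ mI x u v xI intf der _ G0 intG Gub).
rewrite -derive1E (@differentiation_under_integral R _ _ mu h _ mI x u v xI intf der _
  G0 intG Gub).
apply: eq_Rintegral => t; rewrite inE /= in_itv /= => ta.
exact: DE.
Qed.

Definition pt (a b : R) : 'rV[R]_2 := \row_j if j == 0 then a else b.

Lemma pt_eta (z : 'rV[R]_2) : pt (z 0 0) (z 0 1) = z.
Proof.
apply/rowP => j; rewrite mxE; have [->//|j0] := eqVneq j 0.
by congr (z _ _); apply/val_inj; case: j j0 => -[|[|]].
Qed.

Lemma is_derive_pt0 (u : 'rV[R]_2 -> R) (a b df : R) :
  is_derive (pt a b) (delta_mx 0 0) u df -> is_derive a 1 (fun s => u (pt s b)) df.
Proof.
have E s : pt s b = pt 0 b + s *: delta_mx 0 0.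
  by apply/rowP => j; rewrite !mxE eqxx /=; case: (j == 0);
    rewrite ?mulr1 ?add0r ?mulr0 ?addr0.
rewrite E => /is_derive_line; congr is_derive; apply/funext => s; by rewrite -E.
Qed.

Lemma is_derive_pt1 (u : 'rV[R]_2 -> R) (a b df : R) :
  is_derive (pt a b) (delta_mx 0 1) u df -> is_derive b 1 (fun s => u (pt a s)) df.
Proof.
have E s : pt a s = pt a 0 + s *: delta_mx 0 1.
  apply/rowP => j; rewrite !mxE eqxx /=; case: j => -[|[|//]] j /=.
    by rewrite mulr0 addr0.
  by rewrite mulr1 add0r.
rewrite E => /is_derive_line; congr is_derive; apply/funext => s; by rewrite -E.
Qed.

Lemma is_derive_of_pt0 (H : R -> R -> R) (z : 'rV[R]_2) df :
  is_derive (z 0 0) 1 (fun s => H s (z 0 1)) df ->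
  is_derive z (delta_mx 0 0) (fun y : 'rV[R]_2 => H (y 0 0) (y 0 1)) df.
Proof.
move=> [ud uD].
have E : (fun h : R => h^-1 *: (((fun y : 'rV[R]_2 =>
  H (y 0 0) (y 0 1)) \o shift z) (h *: delta_mx 0 0) - H (z 0 0) (z 0 1)))
  = (fun h : R => h^-1 *: (((fun s => H s (z 0 1)) \o shift (z 0 0)) (h *: 1) - H (z 0
    0) (z 0 1))).
  by apply/funext => h /=; rewrite !mxE /= mulr0 add0r.
apply: DeriveDef; first by rewrite /derivable E.
by rewrite /derive E.
Qed.

Lemma is_derive_of_pt1 (H : R -> R -> R) (z : 'rV[R]_2) df :
  is_derive (z 0 1) 1 (fun s => H (z 0 0) s) df ->
  is_derive z (delta_mx 0 1) (fun y : 'rV[R]_2 => H (y 0 0) (y 0 1)) df.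
Proof.
move=> [ud uD].
have E : (fun h : R => h^-1 *: (((fun y : 'rV[R]_2 =>
  H (y 0 0) (y 0 1)) \o shift z) (h *: delta_mx 0 1) - H (z 0 0) (z 0 1)))
  = (fun h : R => h^-1 *: (((fun s => H (z 0 0) s) \o shift (z 0 1)) (h *: 1) - H (z 0
    0) (z 0 1))).
  by apply/funext => h /=; rewrite !mxE /= mulr0 add0r.
apply: DeriveDef; first by rewrite /derivable E.
by rewrite /derive E.
Qed.

Lemma continuous_pt1 (a b : R) : {for b, continuous (pt a)}.
Proof.
apply/cvgrPdist_lt => e e0; apply/nbhs_ballP; exists e => //= t bt.
have {}bt : `|b - t| < e by exact: bt.
apply: le_lt_trans bt; apply: norm_row_le => // j; rewrite !mxE.
by case: ifP => _; rewrite ?subrr ?normr0.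
Qed.

Lemma continuous_pt0 (a b : R) : {for a, continuous (pt^~ b)}.
Proof.
apply/cvgrPdist_lt => e e0; apply/nbhs_ballP; exists e => //= t bt.
have {}bt : `|a - t| < e by exact: bt.
apply: le_lt_trans bt; apply: norm_row_le => // j; rewrite !mxE.
by case: ifP => _; rewrite ?subrr ?normr0.
Qed.

(** The primitive integrates [P] along the bottom edge of a square and then [Q] vertically. Its
    second derivative is the fundamental theorem of calculus; the first needs differentiation under
    the integral and the closedness of the form. The base point is the lower corner, not the centre,
    so that both integrals run upwards. Halving the radius puts the closed square inside the
    ball. *)
Lemma poincare (p : 'rV[R]_2) (r : R) (P Q : 'rV[R]_2 -> R) : 0 < r ->
  smooth_on (ball p r) P -> smooth_on (ball p r) Q ->
  (forall x, ball p r x -> pd 1 P x = pd 0 Q x) ->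
  exists H : 'rV[R]_2 -> R, forall x, ball p (r / 2) x ->
    is_derive x (delta_mx 0 0) H (P x) /\ is_derive x (delta_mx 0 1) H (Q x).
Proof.
move=> r0 sP sQ PQ.
pose rho := r / 2.
have rho0 : 0 < rho by rewrite divr_gt0.
have rhor : rho < r by rewrite /rho; lra.
pose a0 := p 0 0 - rho; pose b0 := p 0 0 + rho.
pose a1 := p 0 1 - rho; pose b1 := p 0 1 + rho.
have inb s t : a0 <= s <= b0 -> a1 <= t <= b1 -> ball p r (pt s t).
  move=> /andP[s1 s2] /andP[t1 t2]; split=> // i j; rewrite (ord1 i) mxE.
  rewrite /ball /= ltr_norml; case: ifPn => [/eqP ->|j0].
    by rewrite /a0 /b0 in s1 s2; apply/andP; split; lra.
  have -> : j = 1 by apply/val_inj; case: j j0 => -[|[|]].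
  by rewrite /a1 /b1 in t1 t2; apply/andP; split; lra.
have cQ s t : a0 <= s <= b0 -> a1 <= t <= b1 -> {for t, continuous (fun t =>
  Q (pt s t))}.
  move=> sI tI; apply: continuous_comp; first exact: continuous_pt1.
  exact: smooth_on_continuous sQ (inb s t sI tI).
have cP s t : a0 <= s <= b0 -> a1 <= t <= b1 -> {for s, continuous (fun s =>
  P (pt s t))}.
  move=> sI tI; apply: (@continuous_comp _ _ _ (pt^~ t) P); first exact: continuous_pt0.
  exact: smooth_on_continuous sP (inb s t sI tI).
have a1I : a1 <= a1 <= b1 by rewrite lexx /a1 /b1; lra.
(* Compactness of the closed square gives the bound that dominates the integrand when
   differentiating under the integral. *)
have [C CQ] : exists C, forall s t, a0 <= s <= b0 -> a1 <= t <= b1 ->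
  `|pd 0 Q (pt s t)| <= C.
  pose I (i : 'I_2) : set R := if i == 0 then `[a0, b0]%classic else `[a1, b1]%classic.
  pose A := [set v : 'rV[R]_2 | forall i, I i (v ord0 i)].
  have cA : compact A.
    by apply: rV_compact => i; rewrite /I; case: ifP => _; exact: segment_compact.
  have Apt s t : a0 <= s <= b0 -> a1 <= t <= b1 -> A (pt s t).
    by move=> sI tI i; rewrite /I mxE; case: ifP => _ /=; rewrite in_itv.
  have Ainb v : A v -> ball p r v.
    move=> Av; rewrite -(pt_eta v); have := Av 0; have := Av 1.
    by rewrite /I /= !in_itv /= => h1 h0; apply: inb.
  have A0 : A !=set0.
    by exists (pt a0 a1); apply: Apt => //; rewrite lexx /a0 /b0; lra.
  have [|c _ cmax] := @EVT_max_rV R 2 (fun v => `|pd 0 Q v|) A A0 cA.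
    apply: continuous_in_subspaceT => v; rewrite inE => /Ainb pv.
    apply: (@continuous_comp _ _ _ (pd 0 Q) Num.norm); last exact: norm_continuous.
    exact: smooth_on_continuous (smooth_on_pd 0 sQ) pv.
  exists `|pd 0 Q c| => s t sI tI; apply: cmax; rewrite inE; exact: Apt.
pose F1 x := \int[mu]_(s in `[a0, x]) P (pt s a1).
pose F2 x y := \int[mu]_(t in `[a1, y]) Q (pt x t).
exists (fun z => F1 (z 0 0) + F2 (z 0 0) (z 0 1)) => z [_ pz].
have := pz 0 0; have := pz 0 1; rewrite /ball /= !ltr_norml =>
  /andP[y1 y2] /andP[x1 x2].
set x := z 0 0 in x1 x2 *; set y := z 0 1 in y1 y2 *.
have xI : a0 < x < b0 by rewrite /a0 /b0 /rho; apply/andP; split; lra.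
have yI : a1 < y < b1 by rewrite /a1 /b1 /rho; apply/andP; split; lra.
have xI' : a0 <= x <= b0 by case/andP: xI => *; rewrite !ltW.
have sub t : a1 <= t <= y -> a1 <= t <= b1.
  by move=> /andP[-> ty] /=; rewrite (le_trans ty) // ltW //; case/andP: yI.
have sub0 s : a0 < s < b0 -> a0 <= s <= b0 by move=> /andP[*]; rewrite !ltW.
have dF1 : is_derive x 1 F1 (P (pt x a1)).
  by apply: (@is_derive_integral (fun s => P (pt s a1)) a0 x b0) => // s sI; exact: cP.
split.
- apply: (is_derive_of_pt0 (H := fun x y => F1 x + F2 x y)).
  have dF2 : is_derive x 1 (F2^~ y) (\int[mu]_(t in `[a1, y]) pd 0 Q (pt x t)).
    apply: (@is_derive_under_integral (fun x t => Q (pt x t)) (fun x t =>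
      pd 0 Q (pt x t)) a0 b0 x a1 y C) => //.
    + by move=> s t /sub0 sI /sub tI; exact: cQ.
    + move=> s t /sub0 sI /sub tI; apply: is_derive_pt0.
      exact: smooth_is_derive sQ (inb s t sI tI).
    + by move=> s t /sub0 sI /sub tI; exact: CQ.
  have -> : P z = P (pt x a1) + \int[mu]_(t in `[a1, y]) pd 0 Q (pt x t).
    have -> : \int[mu]_(t in `[a1, y]) pd 0 Q (pt x t) = P (pt x y) - P (pt x a1).
      apply: (@integral_is_derive (fun t => pd 0 Q (pt x t)) (fun t => P (pt x t))).
      - by case/andP: yI.
      - move=> t /sub tI; apply: (@continuous_comp _ _ _ (pt x) (pd 0 Q));
        first exact: continuous_pt1.
        exact: smooth_on_continuous (smooth_on_pd 0 sQ) (inb x t xI' tI).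
      - move=> t /sub tI; rewrite -(PQ _ (inb x t xI' tI)); apply: is_derive_pt1.
        exact: (smooth_is_derive 1 sP (inb x t xI' tI)).
    by rewrite pt_eta addrC subrK.
  exact: is_deriveD.
- apply: (is_derive_of_pt1 (H := fun x y => F1 x + F2 x y)).
  have -> : Q z = 0 + Q (pt x y) by rewrite add0r pt_eta.
  apply: is_deriveD.
  apply: (@is_derive_integral (fun t => Q (pt x t)) a1 y b1) => // t tI.
  exact: cQ.
Qed.

End PoincareLemma.

(** * Curvature of a surface *)

Lemma sum_ord2 (V : nmodType) (h : 'I_2 -> V) : \sum_i h i = h 0 + h 1.
Proof. by rewrite !big_ord_recl big_ord0 addr0; congr (_ + h _); apply/val_inj. Qed.

Lemma ord2P (i : 'I_2) : i = 0 \/ i = 1.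
Proof. by case: i => -[|[|//]] ?; [left|right]; exact/val_inj. Qed.

Section SurfaceCurvature.
Context {R : realType}.

(* Christoffel symbols of the first kind: the l-th covariant component of
   the derivative of d_j in the direction d_i. *)
Definition lowchr n (g : 'rV[R]_n -> 'M[R]_n) (i j l : 'I_n) (x : 'rV[R]_n) : R :=
  2^-1 * (pd i (fun y => g y j l) x + pd j (fun y => g y i l) x
          - pd l (fun y => g y i j) x).

Lemma christoffel_lowchr n (g : 'rV[R]_n -> 'M[R]_n) k i j x :
  christoffel g k i j x = \sum_l invmx (g x) k l * lowchr g i j l x.
Proof.
rewrite /christoffel mulr_sumr; apply: eq_bigr => l _.
by rewrite /lowchr mulrCA.
Qed.

Lemma smooth_lowchr n (U : set 'rV[R]_n) (g : 'rV[R]_n -> 'M[R]_n) i j l :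
  open U -> (forall i j, smooth_on U (fun x => g x i j)) ->
  smooth_on U (lowchr g i j l).
Proof.
move=> oU sg; apply: (smoothM oU (smooth_cst oU _)).
apply: (smoothB oU); last exact: smooth_on_pd.
by apply: (smoothD oU); exact: smooth_on_pd.
Qed.

Variables (E F G : 'rV[R]_2 -> R).
Local Notation g := (metric2 E F G).
Local Notation Delta := (fun x => E x * G x - F x ^+ 2).

Lemma metric200 : (fun x => g x 0 0) = E. Proof. by apply/funext => x; rewrite mxE. Qed.
Lemma metric201 : (fun x => g x 0 1) = F. Proof. by apply/funext => x; rewrite mxE. Qed.
Lemma metric210 : (fun x => g x 1 0) = F. Proof. by apply/funext => x; rewrite mxE. Qed.
Lemma metric211 : (fun x => g x 1 1) = G. Proof. by apply/funext => x; rewrite mxE. Qed.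
Definition metric2E := (metric200, metric201, metric210, metric211).

Lemma lowchr_metric2 x :
  ((lowchr g 0 0 0 x = pd 0 E x / 2) * (lowchr g 0 0 1 x = pd 0 F x - pd 1 E x / 2) *
   (lowchr g 0 1 0 x = pd 1 E x / 2) * (lowchr g 0 1 1 x = pd 0 G x / 2) *
   (lowchr g 1 0 0 x = pd 1 E x / 2) * (lowchr g 1 0 1 x = pd 0 G x / 2) *
   (lowchr g 1 1 0 x = pd 1 F x - pd 0 G x / 2) * (lowchr g 1 1 1 x = pd 1 G x /
     2))%type.
Proof.
rewrite /lowchr !metric2E.
move: (pd 0 E x) (pd 1 E x) (pd 0 F x) (pd 1 F x) (pd 0 G x) (pd 1 G x) => *.
by do !split; field.
Qed.

Lemma det_metric2 x : \det (g x) = Delta x.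
Proof.
rewrite (expand_det_row _ 0) sum_ord2 /cofactor !det_mx11 !mxE /=.
by rewrite expr0 expr1 mul1r mulN1r mulrN -expr2.
Qed.

Lemma invmx_metric2 x : Delta x != 0 ->
  (invmx (g x) 0 0 = G x / Delta x) /\ (invmx (g x) 0 1 = - F x / Delta x) /\
  (invmx (g x) 1 0 = - F x / Delta x) /\ (invmx (g x) 1 1 = E x / Delta x).
Proof.
move=> D0; pose B := (Delta x)^-1 *: metric2 G (fun y => - F y) E x.
have gB : g x *m B = 1%:M.
  apply/matrixP => i j; rewrite mxE sum_ord2 !mxE.
  case: i => -[|[|//]] ?; case: j => -[|[|//]] ? /=; rewrite ?mulr1n ?mulr0n;
  by field.
have ug : g x \in unitmx by case/mulmx1_unit: gB.
have -> : invmx (g x) = B by rewrite -[LHS]mulmx1 -gB mulKmx.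
by rewrite !mxE /= !(mulrC _^-1).
Qed.

Lemma christoffel_metric2 x i j : Delta x != 0 ->
  christoffel g 0 i j x = (G x * lowchr g i j 0 x - F x * lowchr g i j 1 x) / Delta x /\
  christoffel g 1 i j x = (E x * lowchr g i j 1 x - F x * lowchr g i j 0 x) / Delta x.
Proof.
move=> D0; rewrite !christoffel_lowchr !sum_ord2.
have [-> [-> [-> ->]]] := invmx_metric2 D0.
move: (lowchr g i j 0 x) (lowchr g i j 1 x) D0.
move: (E x) (F x) (G x) => e f h a b D0; clear -D0.
by split; field.
Qed.

(* The covariant curvature component R_0110, in a form where the only
   second derivatives of the metric are those of Christoffel symbols of the
   first kind. *)
Definition lowcurv (x : 'rV[R]_2) : R :=
  pd 0 (lowchr g 1 1 0) x - pd 1 (lowchr g 0 1 0) x -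
  (G x * (lowchr g 1 1 0 x * lowchr g 0 0 0 x - lowchr g 0 1 0 x ^+ 2)
   - F x * (lowchr g 1 1 0 x * lowchr g 0 0 1 x + lowchr g 1 1 1 x * lowchr g 0 0 0 x
            - 2 * lowchr g 0 1 0 x * lowchr g 0 1 1 x)
   + E x * (lowchr g 1 1 1 x * lowchr g 0 0 1 x - lowchr g 0 1 1 x ^+ 2)) / Delta x.

(** Serves to differentiate the index-lowering relation between the two kinds of Christoffel
    symbols, instead of the quotients that solve it. *)
Lemma pd_combination (U : set 'rV[R]_2) (a b u v w : 'rV[R]_2 -> R) i x : open U ->
  smooth_on U a -> smooth_on U b -> smooth_on U u -> smooth_on U v ->
  (forall y, U y -> a y * u y + b y * v y = w y) -> U x ->
  pd i w x = a x * pd i u x + u x * pd i a x + (b x * pd i v x + v x * pd i b x).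
Proof.
move=> oU sa sb su sv abw Ux; rewrite -(pd_eq_on i oU abw Ux).
apply: pd_val; apply: is_deriveD; apply: is_deriveM.
- exact: (smooth_is_derive i sa Ux).
- exact: (smooth_is_derive i su Ux).
- exact: (smooth_is_derive i sb Ux).
- exact: (smooth_is_derive i sv Ux).
Qed.

(** The numerator of the curvature contracts the derivatives of the Christoffel symbols with the
    metric. Moving the metric inside the derivative leaves derivatives of lowered symbols and
    products of first-order terms, and what remains is a rational identity. *)
Lemma gauss_curvature_lowcurv (U : set 'rV[R]_2) x : open U ->
  smooth_on U E -> smooth_on U F -> smooth_on U G ->
  (forall y, U y -> Delta y != 0) -> U x ->
  gauss_curvature g x * Delta x = lowcurv x.
Proof.
move=> oU sE sF sG D0 Ux.
have sg i j : smooth_on U (fun x => g x i j).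
  by have [->|->] := ord2P i; have [->|->] := ord2P j; rewrite metric2E.
have sl i j l : smooth_on U (lowchr g i j l) by exact: smooth_lowchr.
have sD : smooth_on U Delta by apply: (smoothB oU); [exact: smoothM|exact: smoothX].
have sDV : smooth_on U (fun x => (Delta x)^-1) by exact: smoothV.
have sC k i j : smooth_on U (christoffel g k i j).
  have [->|->] := ord2P k.
    apply: (smooth_on_eq oU (f := fun x => (G x * lowchr g i j 0 x - F x * lowchr g i j
      1 x) / Delta x)).
      by move=> y Uy; have [-> _] := christoffel_metric2 i j (D0 y Uy).
    exact: (smoothM oU (smoothB oU (smoothM oU sG (sl i j 0)) (smoothM oU sF (sl i j
      1))) sDV).
  apply: (smooth_on_eq oU (f := fun x => (E x * lowchr g i j 1 x - F x * lowchr g i j 0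
    x) / Delta x)).
    by move=> y Uy; have [_ ->] := christoffel_metric2 i j (D0 y Uy).
  exact: (smoothM oU (smoothB oU (smoothM oU sE (sl i j 1)) (smoothM oU sF (sl i j 0)))
    sDV).
have EF i j y : U y ->
    E y * christoffel g 0 i j y + F y * christoffel g 1 i j y = lowchr g i j 0 y.
  move=> Uy; have [-> ->] := christoffel_metric2 i j (D0 y Uy).
  have := D0 y Uy; move: (lowchr g i j 0 y) (lowchr g i j 1 y) (E y) (F y) (G y).
  by move=> a b e f h D; field.
rewrite /gauss_curvature det_metric2 sum_ord2 (mulfVK (D0 x Ux)) !mxE /=.
rewrite /riemann !sum_ord2 /lowcurv.
have := pd_combination 0 oU sE sF (sC 0 1 1) (sC 1 1 1) (EF 1 1) Ux.
have := pd_combination 1 oU sE sF (sC 0 0 1) (sC 1 0 1) (EF 0 1) Ux.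
move: (pd 0 (lowchr g 1 1 0) x) (pd 1 (lowchr g 0 1 0) x).
move: (pd 0 (christoffel g 0 1 1) x) (pd 0 (christoffel g 1 1 1) x).
move: (pd 1 (christoffel g 0 0 1) x) (pd 1 (christoffel g 1 0 1) x).
have Dx := D0 x Ux.
have [-> ->] := christoffel_metric2 0 0 Dx.
have [-> ->] := christoffel_metric2 0 1 Dx.
have [-> ->] := christoffel_metric2 1 0 Dx.
have [-> ->] := christoffel_metric2 1 1 Dx.
rewrite !lowchr_metric2.
move: Dx; move: (pd 0 E x) (pd 1 E x) (pd 0 F x) (pd 1 F x) (pd 0 G x) (pd 1 G x).
move: (E x) (F x) (G x) => e f h e0 e1 f0 f1 h0 h1 Dx B0 B1 A0 A1 L1 L0 -> ->.
by field.
Qed.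

End SurfaceCurvature.

Lemma riemannian_metric2 (R : realType) (U : set 'rV[R]_2) (E F G : 'rV[R]_2 -> R) x :
  riemannian_metric U (metric2 E F G) -> U x ->
  0 < E x /\ 0 < E x * G x - F x ^+ 2.
Proof.
move=> [_ pos] Ux; have {pos}[_ pos] := pos x Ux.
have quad (a b : R) : (a, b) != (0, 0) ->
    0 < a ^+ 2 * E x + 2 * a * b * F x + b ^+ 2 * G x.
  move=> ab; have := pos (\row_j if j == 0 then a else b).
  have -> : ((\row_j (if j == 0 then a else b)) *m metric2 E F G x *m
      (\row_j (if j == 0 then a else b))^T) 0 0 =
      a ^+ 2 * E x + 2 * a * b * F x + b ^+ 2 * G x.
    by rewrite mxE sum_ord2 !mxE !sum_ord2 !mxE /=; ring.
  apply; apply: contra_neq ab => /rowP v0.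
  by have := v0 0; have := v0 1; rewrite !mxE /= => -> ->.
have E0 : 0 < E x.
  have := quad 1 0; rewrite expr1n mul1r expr0n /= mulr0 !mul0r !addr0; apply.
  by rewrite xpair_eqE oner_eq0.
split=> //.
(* The vector (-F, E) is orthogonal to the first coordinate vector, and its square norm is E
   Delta. *)
have := quad (- F x) (E x).
have -> : (- F x) ^+ 2 * E x + 2 * - F x * E x * F x + E x ^+ 2 * G x =
  E x * (E x * G x - F x ^+ 2) by ring.
rewrite pmulr_rgt0 //; apply.
by rewrite xpair_eqE negb_and (gt_eqF E0) orbT.
Qed.

(* Keeps unification from comparing iterated derivatives by unfolding them. *)
Local Opaque pd.

(** * The Gauss equation *)

Section Dot.
Context {R : realType} {m : nat}.
Implicit Types (u v w : 'rV[R]_m).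

Definition dot u v : R := (u *m v^T) 0 0.

Lemma dotE u v : dot u v = \sum_k u 0 k * v 0 k.
Proof. by rewrite /dot mxE; apply: eq_bigr => k _; rewrite mxE. Qed.

Lemma dotC u v : dot u v = dot v u.
Proof. by rewrite !dotE; apply: eq_bigr => k _; rewrite mulrC. Qed.

Lemma dotDl u v w : dot (u + v) w = dot u w + dot v w.
Proof. by rewrite /dot mulmxDl mxE. Qed.

Lemma dotBl u v w : dot (u - v) w = dot u w - dot v w.
Proof. by rewrite /dot mulmxBl !mxE. Qed.

Lemma dotZl a u w : dot (a *: u) w = a * dot u w.
Proof. by rewrite /dot -scalemxAl mxE. Qed.

Lemma dot_ge0 u : 0 <= dot u u.
Proof. by rewrite dotE sumr_ge0 // => k _; rewrite -expr2 sqr_ge0. Qed.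

Lemma dot_eq0 u : dot u u = 0 -> u = 0.
Proof.
rewrite dotE => /eqP; rewrite psumr_eq0 => [/allP u0|k _];
  last by rewrite -expr2 sqr_ge0.
apply/rowP => k; rewrite mxE; have := u0 k (mem_index_enum k).
by rewrite -expr2 sqrf_eq0 => /eqP.
Qed.

Lemma dot_row0 k (A : 'M[R]_(k, m)) u :
  (forall i, dot u (row i A) = 0) <-> u *m A^T = 0.
Proof.
have E i : dot u (row i A) = (u *m A^T) 0 i.
  by rewrite dotE mxE; apply: eq_bigr => j _; rewrite !mxE.
by split=> [uA|uA i]; [apply/rowP => i; rewrite -E uA mxE|rewrite E uA mxE].
Qed.

End Dot.

(** The kernel of the transpose is a line, because [A] has rank n in dimension n + 1. The last
    clause is the form in which spanning is used: vector identities are checked by scalar products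
    with the frame. *)
Lemma unit_normal (R : realType) n (A : 'M[R]_(n, n.+1)) : row_free A ->
  exists nu : 'rV[R]_n.+1, [/\ dot nu nu = 1, forall i, dot (row i A) nu = 0 &
    forall u, (forall i, dot u (row i A) = 0) -> dot u nu = 0 -> u = 0].
Proof.
move=> Afree; have rK : \rank (kermx A^T) = 1%N.
  by rewrite mxrank_ker mxrank_tr (eqP Afree) subSnn.
pose n0 := nz_row (kermx A^T).
have n00 : n0 != 0 by rewrite nz_row_eq0 -mxrank_eq0 rK.
have n0K : (n0 <= kermx A^T)%MS by exact: nz_row_sub.
have nuE : (kermx A^T <= n0)%MS.
  by rewrite -(mxrank_leqif_sup n0K) rank_rV n00 rK.
have d0 : 0 < dot n0 n0.
  rewrite lt_neqAle dot_ge0 andbT eq_sym; apply: contra n00 => /eqP h.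
  by apply/eqP; exact: dot_eq0.
pose s := Num.sqrt (dot n0 n0).
have s0 : s != 0 by rewrite gt_eqF // sqrtr_gt0.
have s2 : dot n0 n0 = s ^+ 2 by rewrite sqr_sqrtr // ltW.
exists (s^-1 *: n0); split=> [|i|u uA un].
- by rewrite dotZl dotC dotZl s2; field.
- rewrite dotC dotZl; have /sub_kermxP/dot_row0 -> := n0K; exact: mulr0.
- have /sub_rVP[a ua] : (u <= n0)%MS.
    by apply: submx_trans nuE; apply/sub_kermxP/dot_row0.
  move: un; rewrite ua dotZl dotC dotZl s2 => /eqP.
  by rewrite !mulf_eq0 invr_eq0 (negbTE s0) !orbF => /eqP ->; rewrite scale0r.
Qed.


Section GaussEquation.
Context {R : realType} {n m : nat} (M : set 'rV[R]_n) (phi : 'rV[R]_n -> 'rV[R]_m)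
  (g : 'rV[R]_n -> 'M[R]_n).
Hypotheses (oM : open M) (sphi : smooth_map_on M phi)
  (iso : forall x, M x -> pullback_euclidean phi x = g x).

Definition tangent i x : 'rV[R]_m := \row_k pd i (fun y => phi y 0 k) x.
Definition second i j x : 'rV[R]_m := \row_k pd i (pd j (fun y => phi y 0 k)) x.

Lemma row_jac i x : row i (jac phi x) = tangent i x.
Proof. by apply/rowP => k; rewrite !mxE. Qed.

Lemma second_sym i j x : M x -> second i j x = second j i x.
Proof. by move=> Mx; apply/rowP => k; rewrite [LHS]mxE [RHS]mxE;
  exact: (schwarz i j oM (sphi k) Mx). Qed.

Lemma dot_tangent i j x : M x -> dot (tangent i x) (tangent j x) = g x i j.
Proof.
move=> /iso <-; rewrite dotE !mxE; apply: eq_bigr => k _.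
by rewrite !mxE.
Qed.

Lemma pd_dot (a b : 'I_m -> 'rV[R]_n -> R) l x :
  (forall k, smooth_on M (a k)) -> (forall k, smooth_on M (b k)) -> M x ->
  pd l (fun y => dot (\row_k a k y) (\row_k b k y)) x =
  dot (\row_k pd l (a k) x) (\row_k b k x) + dot (\row_k a k x) (\row_k pd l (b k) x).
Proof.
move=> sa sb Mx; apply: pd_val.
rewrite !dotE -big_split /=.
rewrite (_ : (fun y => _) = \sum_k (fun y => a k y * b k y)); last first.
  by apply/funext => y; rewrite dotE fct_sumE; apply: eq_bigr => k _; rewrite !mxE.
apply: is_derive_sum => k; rewrite !mxE addrC (mulrC (pd l (a k) x)).
by apply: is_deriveM; [exact: (smooth_is_derive l (sa k) Mx)|exact: (smooth_is_derive l
  (sb k) Mx)].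
Qed.

(** Differentiating g_bc = phi_b . phi_c gives two products of this kind; in the alternating sum
    defining [lowchr] all but the wanted one cancel by symmetry of second derivatives. *)
Lemma koszul i j l x : M x -> dot (second i j x) (tangent l x) = lowchr g i j l x.
Proof.
move=> Mx.
have D a b c : pd a (fun y => g y b c) x =
    dot (second a b x) (tangent c x) + dot (second a c x) (tangent b x).
  have sp d k : smooth_on M (pd d (fun y => phi y 0 k)) by exact: smooth_on_pd.
  rewrite [X in _ + X]dotC -(pd_dot a (sp b) (sp c) Mx).
  apply: (pd_eq_on a oM _ Mx) => y My; exact/esym/dot_tangent.
rewrite /lowchr !D (second_sym j i Mx) (second_sym l i Mx) (second_sym l j Mx).
have alg (p q r : R) : p = 2^-1 * (p + q + (p + r) - (q + r)) by field.
exact: alg.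
Qed.

(** Differentiating [koszul] produces third derivatives, which cancel by symmetry. The second
    derivatives on the right keep their tangential parts; splitting these off is left to
    [frame_dot]. *)
Lemma gauss_equation i j k l x : M x ->
  pd k (lowchr g i j l) x - pd j (lowchr g i k l) x =
  dot (second i j x) (second k l x) - dot (second i k x) (second j l x).
Proof.
move=> Mx.
have D a b c : pd a (lowchr g i b c) x =
    dot (\row_p pd a (pd i (pd b (fun y => phi y 0 p))) x) (tangent c x) +
    dot (second i b x) (second a c x).
  have sp d p : smooth_on M (pd d (fun y => phi y 0 p)) by exact: smooth_on_pd.
  have sp2 d e p : smooth_on M (pd d (pd e (fun y =>
    phi y 0 p))) by exact: smooth_on_pd.
  rewrite -(pd_dot a (sp2 i b) (sp c) Mx).
  apply: (pd_eq_on a oM _ Mx) => y My; exact/esym/koszul.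
rewrite !D.
have third : (\row_p pd k (pd i (pd j (fun y => phi y 0 p))) x) =
          (\row_p pd j (pd i (pd k (fun y => phi y 0 p))) x) :> 'rV[R]_m.
  apply/rowP => p; rewrite [LHS]mxE [RHS]mxE.
  apply: etrans (schwarz k i oM (smooth_on_pd j (sphi p)) Mx) _.
  apply: etrans _ (schwarz i j oM (smooth_on_pd k (sphi p)) Mx).
  by apply: (pd_eq_on i oM _ Mx) => y My; exact: (schwarz k j oM (sphi p) My).
have alg (A B t : 'rV[R]_m) (b c : R) : A = B -> dot A t + b - (dot B t + c) = b - c.
  by move=> ->; ring.
exact: (alg _ _ _ _ _ third).
Qed.

End GaussEquation.

(** * Warped products *)

Section WarpedMetric.
Context {R : realType}.
Variables (g : 'rV[R]_2 -> 'M[R]_2) (f : 'rV[R]_2 -> R).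
Local Notation w := (warped_metric g f).
Local Notation L i := (lshift 1 i : 'I_(2 + 1)).
Local Notation T := (rshift 2 0 : 'I_(2 + 1)).

Lemma pd_cst n (i : 'I_n) (c : R) : pd i (fun=> c) = (fun=> 0) :> ('rV[R]_n -> R).
Proof. by apply/funext => x; apply: pd_val; exact: is_derive_cst. Qed.

Lemma pd_lsubmx_l (u : 'rV[R]_2 -> R) i :
  pd (L i) (fun y : 'rV[R]_(2 + 1) => u (lsubmx y)) = (fun y => pd i u (lsubmx y)).
Proof. by apply/funext => x; exact: pd_lift_l. Qed.

Lemma pd_lsubmx_r (u : 'rV[R]_2 -> R) :
  pd T (fun y : 'rV[R]_(2 + 1) => u (lsubmx y)) = (fun=> 0).
Proof. by apply/funext => x; exact: pd_lift_r. Qed.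

Lemma warpedLL i j : (fun y => w y (L i) (L j)) = (fun y => g (lsubmx y) i j).
Proof. by apply/funext => y; rewrite block_mxEul. Qed.

Lemma warpedLT i : (fun y => w y (L i) T) = (fun=> 0).
Proof. by apply/funext => y; rewrite block_mxEur mxE. Qed.

Lemma warpedTL i : (fun y => w y T (L i)) = (fun=> 0).
Proof. by apply/funext => y; rewrite block_mxEdl mxE. Qed.

Lemma warpedTT : (fun y => w y T T) = (fun y => f (lsubmx y) ^+ 2).
Proof. by apply/funext => y; rewrite block_mxEdr mxE eqxx mulr1n. Qed.

(** The metric does not depend on the fibre coordinate [T] and has no mixed entries, so symbols with
    one or three fibre indices vanish, and those with two are half a derivative of f^2 up to
    sign. *)
Lemma lowchrLLL i j l : lowchr w (L i) (L j) (L l) = (fun y =>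
  lowchr g i j l (lsubmx y)).
Proof.
apply/funext => x; rewrite /lowchr !warpedLL.
by rewrite (pd_lsubmx_l (fun z => g z j l)) (pd_lsubmx_l (fun z =>
  g z i l)) (pd_lsubmx_l (fun z => g z i j)).
Qed.

Lemma lowchrLLT i j : lowchr w (L i) (L j) T = (fun=> 0).
Proof.
apply/funext => x; rewrite /lowchr !warpedLL !warpedLT.
by rewrite (pd_lsubmx_r (fun z => g z i j)) !pd_cst addr0 subr0 mulr0.
Qed.

Lemma lowchrLTL i l : lowchr w (L i) T (L l) = (fun=> 0).
Proof.
apply/funext => x; rewrite /lowchr warpedLL warpedLT warpedTL.
by rewrite (pd_lsubmx_r (fun z => g z i l)) !pd_cst addr0 subr0 mulr0.
Qed.

Lemma lowchrLTT i : lowchr w (L i) T T =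
  (fun y => 2^-1 * pd i (fun z => f z ^+ 2) (lsubmx y)).
Proof.
apply/funext => x; rewrite /lowchr warpedTT warpedLT.
by rewrite (pd_lsubmx_l (fun z => f z ^+ 2)) !pd_cst addr0 subr0.
Qed.

Lemma lowchrTTL l : lowchr w T T (L l) =
  (fun y => - (2^-1 * pd l (fun z => f z ^+ 2) (lsubmx y))).
Proof.
apply/funext => x; rewrite /lowchr warpedTT warpedTL.
by rewrite (pd_lsubmx_l (fun z => f z ^+ 2)) !pd_cst addr0 sub0r mulrN.
Qed.

Lemma lowchrTTT : lowchr w T T T = (fun=> 0).
Proof.
apply/funext => x; rewrite /lowchr warpedTT.
by rewrite (pd_lsubmx_r (fun z => f z ^+ 2)) addr0 subr0 mulr0.
Qed.

End WarpedMetric.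

(** Parseval's identity for a frame whose Gram matrix is block diagonal: the difference of [v] and
    its expansion is orthogonal to the frame, hence 0. *)
Lemma frame_dot (R : realType) m (P0 P1 P2 nu : 'rV[R]_m) (E F G s : R) :
  E * G - F ^+ 2 != 0 -> s != 0 ->
  dot P0 P0 = E -> dot P0 P1 = F -> dot P1 P1 = G ->
  dot P0 P2 = 0 -> dot P1 P2 = 0 -> dot P2 P2 = s ^+ 2 ->
  dot P0 nu = 0 -> dot P1 nu = 0 -> dot P2 nu = 0 -> dot nu nu = 1 ->
  (forall u, dot u P0 = 0 -> dot u P1 = 0 -> dot u P2 = 0 -> dot u nu = 0 -> u = 0) ->
  forall v w, dot v w =
    (G * dot v P0 * dot w P0 - F * (dot v P0 * dot w P1 + dot v P1 * dot w P0)
     + E * dot v P1 * dot w P1) / (E * G - F ^+ 2)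
    + dot v P2 * dot w P2 / s ^+ 2 + dot v nu * dot w nu.
Proof.
move=> D0 s0 e00 e01 e11 e02 e12 e22 n0 n1 n2 nn uniq v w.
pose D := E * G - F ^+ 2.
have vE : v = ((G * dot v P0 - F * dot v P1) / D) *: P0 +
    ((E * dot v P1 - F * dot v P0) / D) *: P1 + (dot v P2 / s ^+ 2) *: P2 +
    dot v nu *: nu.
  apply/eqP; rewrite -subr_eq0; apply/eqP; apply: uniq;
    rewrite dotBl !dotDl !dotZl.
  - rewrite e00 (dotC P1) e01 (dotC P2) e02 (dotC nu) n0 /D.
    by move: (dot v P0) (dot v P1) (dot v P2) (dot v nu) => *; field; rewrite D0 s0.
  - rewrite e01 e11 (dotC P2) e12 (dotC nu) n1 /D.
    by move: (dot v P0) (dot v P1) (dot v P2) (dot v nu) => *; field; rewrite D0 s0.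
  - rewrite e02 e12 e22 (dotC nu) n2.
    by move: (dot v P0) (dot v P1) (dot v P2) (dot v nu) => *; field; rewrite D0 s0.
  - rewrite n0 n1 n2 nn.
    by move: (dot v P0) (dot v P1) (dot v P2) (dot v nu) => *; field; rewrite D0 s0.
rewrite {1}vE !dotDl !dotZl (dotC P0) (dotC P1) (dotC P2) (dotC nu) /D.
move: (dot v P0) (dot v P1) (dot v P2) (dot v nu) (dot w P0) (dot w P1) (dot w P2) (dot
  w nu) => *.
by field; rewrite D0 s0.
Qed.

(* a, b, c: lowered Christoffel symbols 00, 01, 11; h: second fundamental
   form. The first hypothesis on h is the Gauss equation of the base, the next
   two are the vanishing of the curvature components R_12i3, and the last three
   give the components R_i3j3. *)
Lemma second_fundamental_form_algebra (R : fieldType)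
  (E F G s f0 f1 f00 f01 f11 a0 a1 b0 b1 c0 c1 h00 h01 h11 h02 h12 h22 kD : R) :
  let D := E * G - F ^+ 2 in
  D != 0 -> s != 0 -> kD != 0 ->
  h00 * h11 - h01 ^+ 2 = kD ->
  h00 * h12 - h01 * h02 = 0 -> h11 * h02 - h01 * h12 = 0 ->
  (G * a0 * (- (s * f0)) - F * (a0 * (- (s * f1)) + a1 * (- (s * f0))) + E * a1 * (- (s
    * f1))) / D
    + h00 * h22 - (s * f0 * (s * f0) / s ^+ 2 + h02 * h02) = - (f0 * f0 + s * f00) ->
  (G * b0 * (- (s * f0)) - F * (b0 * (- (s * f1)) + b1 * (- (s * f0))) + E * b1 * (- (s
    * f1))) / D
    + h01 * h22 - (s * f0 * (s * f1) / s ^+ 2 + h02 * h12) = - (f0 * f1 + s * f01) ->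
  (G * c0 * (- (s * f0)) - F * (c0 * (- (s * f1)) + c1 * (- (s * f0))) + E * c1 * (- (s
    * f1))) / D
    + h11 * h22 - (s * f1 * (s * f1) / s ^+ 2 + h12 * h12) = - (f1 * f1 + s * f11) ->
  let H u0 u1 fij := fij - ((G * u0 - F * u1) / D * f0 + (E * u1 - F * u0) / D * f1) in
  [/\ h02 = 0, h12 = 0 &
    s ^+ 2 * (H a0 a1 f00 * H c0 c1 f11 - H b0 b1 f01 ^+ 2) = h22 ^+ 2 * kD].
Proof.
move=> D D0 s0 k0 k e2 e3 g00 g01 g11 H.
(* Cramer's rule for the linear system that [e2] and [e3] form in [h02] and [h12]. *)
have h02_0 : h02 = 0.
  apply: (mulfI k0); rewrite mulr0 -k.
  have -> : (h00 * h11 - h01 ^+ 2) * h02 =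
    h00 * (h11 * h02 - h01 * h12) + h01 * (h00 * h12 - h01 * h02) by ring.
  by rewrite e2 e3; ring.
have h12_0 : h12 = 0.
  apply: (mulfI k0); rewrite mulr0 -k.
  have -> : (h00 * h11 - h01 ^+ 2) * h12 =
    h11 * (h00 * h12 - h01 * h02) + h01 * (h11 * h02 - h01 * h12) by ring.
  by rewrite e2 e3; ring.
split=> //; rewrite h02_0 h12_0 in g00 g01 g11.
have hH (u0 u1 u h v v' : R) :
    (G * u0 * (- (s * f0)) - F * (u0 * (- (s * f1)) + u1 * (- (s * f0))) + E * u1 * (-
      (s * f1))) / D
    + h - (s * v * (s * v') / s ^+ 2 + 0 * 0) = - (v * v' + s * u) ->
    s * H u0 u1 u = - h.
  move=> e; apply/eqP; rewrite -addr_eq0; apply/eqP.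
  transitivity ((G * u0 * (- (s * f0)) - F * (u0 * (- (s * f1)) + u1 * (- (s * f0))) +
    E * u1 * (- (s * f1))) / D
    + h - (s * v * (s * v') / s ^+ 2 + 0 * 0) + (v * v' + s * u)).
    by rewrite /H; field; rewrite D0 s0.
  by rewrite e addNr.
have -> : s ^+ 2 * (H a0 a1 f00 * H c0 c1 f11 - H b0 b1 f01 ^+ 2) =
  (s * H a0 a1 f00) * (s * H c0 c1 f11) - (s * H b0 b1 f01) ^+ 2 by ring.
by rewrite (hH _ _ _ _ _ _ g00) (hH _ _ _ _ _ _ g01) (hH _ _ _ _ _ _ g11) -k; ring.
Qed.

(** The situation at one point, freed of derivatives: the P are the first and the Q the second
    derivatives of the embedding, [lc] is the derivative part of the curvature of the base and [kD]
    stands for K Delta. The Gauss equations are expanded in the frame; [h] is the normal component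
    of [QT]. Once [Q0] and [Q1] have no normal component, their products with the P identify them as
    multiples of [P2]. *)
Lemma warped_second_fundamental_form (R : realType) m
  (P0 P1 P2 nu Q00 Q01 Q11 Q0 Q1 QT : 'rV[R]_m)
  (E F G s f0 f1 f00 f01 f11 a0 a1 b0 b1 c0 c1 lc : R) :
  let D := E * G - F ^+ 2 in
  let kD := lc - (G * (c0 * a0 - b0 ^+ 2) - F * (c0 * a1 + c1 * a0 - 2 * b0 * b1)
                  + E * (c1 * a1 - b1 ^+ 2)) / D in
  D != 0 -> s != 0 -> kD != 0 ->
  dot P0 P0 = E -> dot P0 P1 = F -> dot P1 P1 = G ->
  dot P0 P2 = 0 -> dot P1 P2 = 0 -> dot P2 P2 = s ^+ 2 ->
  dot P0 nu = 0 -> dot P1 nu = 0 -> dot P2 nu = 0 -> dot nu nu = 1 ->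
  (forall u, dot u P0 = 0 -> dot u P1 = 0 -> dot u P2 = 0 -> dot u nu = 0 -> u = 0) ->
  [/\ dot Q00 P0 = a0, dot Q00 P1 = a1 & dot Q00 P2 = 0] ->
  [/\ dot Q01 P0 = b0, dot Q01 P1 = b1 & dot Q01 P2 = 0] ->
  [/\ dot Q11 P0 = c0, dot Q11 P1 = c1 & dot Q11 P2 = 0] ->
  [/\ dot Q0 P0 = 0, dot Q0 P1 = 0 & dot Q0 P2 = s * f0] ->
  [/\ dot Q1 P0 = 0, dot Q1 P1 = 0 & dot Q1 P2 = s * f1] ->
  [/\ dot QT P0 = - (s * f0), dot QT P1 = - (s * f1) & dot QT P2 = 0] ->
  dot Q11 Q00 - dot Q01 Q01 = lc ->
  dot Q00 Q1 - dot Q01 Q0 = 0 -> dot Q11 Q0 - dot Q01 Q1 = 0 ->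
  dot Q00 QT - dot Q0 Q0 = - (f0 * f0 + s * f00) ->
  dot Q01 QT - dot Q0 Q1 = - (f0 * f1 + s * f01) ->
  dot Q11 QT - dot Q1 Q1 = - (f1 * f1 + s * f11) ->
  let H u0 u1 fij := fij - ((G * u0 - F * u1) / D * f0 + (E * u1 - F * u0) / D * f1) in
  exists h : R,
  [/\ s ^+ 2 * (H a0 a1 f00 * H c0 c1 f11 - H b0 b1 f01 ^+ 2) = h ^+ 2 * kD,
      Q0 = (f0 / s) *: P2, Q1 = (f1 / s) *: P2 &
      dot QT QT = s ^+ 2 * (G * f0 ^+ 2 - 2 * F * f0 * f1 + E * f1 ^+ 2) / D + h ^+ 2].
Proof.
move=> D kD D0 s0 k0 e00 e01 e11 e02 e12 e22 n0 n1 n2 nn uniq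
  [q000 q001 q002] [q010 q011 q012] [q110 q111 q112] [q00 q01 q02] [q10 q11 q12]
  [qT0 qT1 qT2].
have fd := frame_dot D0 s0 e00 e01 e11 e02 e12 e22 n0 n1 n2 nn uniq.
rewrite (fd Q11 Q00) (fd Q01 Q01) (fd Q00 Q1) (fd Q01 Q0) (fd Q11 Q0) (fd Q01 Q1) (fd
  Q00 QT)
  (fd Q0 Q0) (fd Q01 QT) (fd Q0 Q1) (fd Q11 QT) (fd Q1 Q1) (fd QT QT).
rewrite q000 q001 q002 q010 q011 q012 q110 q111 q112 q00 q01 q02 q10 q11 q12 qT0 qT1
  qT2.
rewrite -/D => gk g2 g3 g00 g01 g11 H.
set h00 := dot Q00 nu in gk g2 g3 g00 g01 g11.
set h01 := dot Q01 nu in gk g2 g3 g00 g01 g11.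
set h11 := dot Q11 nu in gk g2 g3 g00 g01 g11.
clearbody h00 h01 h11.
have k : h00 * h11 - h01 ^+ 2 = kD.
  rewrite /kD -gk; clear -D0 s0.
  rewrite /D; by field; rewrite D0 s0.
have [h0 h1 hh] : [/\ dot Q0 nu = 0, dot Q1 nu = 0 &
    s ^+ 2 * (H a0 a1 f00 * H c0 c1 f11 - H b0 b1 f01 ^+ 2) = dot QT nu ^+ 2 * kD].
  apply: (second_fundamental_form_algebra D0 s0 k0 k);
    [apply: etrans _ g2|apply: etrans _ g3|apply: etrans _ g00|apply: etrans _
      g01|apply: etrans _ g11];
    move: (dot Q0 nu) (dot Q1 nu) (dot QT nu) => *;
    rewrite /D; by field; rewrite D0 s0.
exists (dot QT nu); split=> //.
- apply/eqP; rewrite -subr_eq0; apply/eqP.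
  apply: uniq; rewrite dotBl dotZl.
  + by rewrite q00 (dotC P2) e02 mulr0 subrr.
  + by rewrite q01 (dotC P2) e12 mulr0 subrr.
  + by rewrite q02 e22; field.
  + by rewrite h0 n2 mulr0 subrr.
- apply/eqP; rewrite -subr_eq0; apply/eqP.
  apply: uniq; rewrite dotBl dotZl.
  + by rewrite q10 (dotC P2) e02 mulr0 subrr.
  + by rewrite q11 (dotC P2) e12 mulr0 subrr.
  + by rewrite q12 e22; field.
  + by rewrite h1 n2 mulr0 subrr.
- clear -D0 s0; move: (dot QT nu) => *; rewrite /D; by field; rewrite D0 s0.
Qed.

(** * Necessity *)

Section Necessity.
Context {R : realType}.
Variables (U : set 'rV[R]_2) (J : set R) (E F G f : 'rV[R]_2 -> R).
Hypotheses (oU : open U) (pcU : path_connected R U) (oJ : open J) (J0 : J !=set0)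
  (sE : smooth_on U E) (sF : smooth_on U F) (sG : smooth_on U G) (sf : smooth_on U f)
  (f_gt0 : forall x, U x -> 0 < f x)
  (mg : riemannian_metric U (metric2 E F G))
  (K0 : forall x, U x -> gauss_curvature (metric2 E F G) x != 0).
Local Notation g := (metric2 E F G).
Local Notation K := (gauss_curvature g).
Local Notation Delta := (fun x => E x * G x - F x ^+ 2).
Local Notation M := (product_domain U J).
Local Notation w := (warped_metric g f).
Local Notation L i := (lshift 1 i : 'I_(2 + 1)).
Local Notation T := (rshift 2 0 : 'I_(2 + 1)).
Local Notation detH := (fun x => hess g f 0 0 x * hess g f 1 1 x - hess g f 0 1 x ^+ 2).

Lemma Delta_gt0 x : U x -> 0 < Delta x.
Proof. by move=> Ux; have [] := riemannian_metric2 mg Ux. Qed.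

Lemma open_product_domain : open M.
Proof.
rewrite (_ : M = (lsubmx @^-1` U) `&` ((fun x : 'rV[R]_(2 + 1) => x 0 T) @^-1` J)).
  apply: openI; apply: open_comp => // x _; first exact: continuous_lsubmx.
  exact: coord_continuous.
by apply/seteqP; split=> x; rewrite /product_domain /= mxE.
Qed.

Lemma hess_metric2 i j x : U x -> hess g f i j x = pd i (pd j f) x -
  ((G x * lowchr g i j 0 x - F x * lowchr g i j 1 x) / Delta x * pd 0 f x +
   (E x * lowchr g i j 1 x - F x * lowchr g i j 0 x) / Delta x * pd 1 f x).
Proof.
move=> Ux; rewrite /hess sum_ord2.
have D0 : Delta x != 0 by rewrite gt_eqF // Delta_gt0.
by have [-> ->] := christoffel_metric2 i j D0.
Qed.

Lemma pd_sqr i x : U x -> pd i (fun z => f z ^+ 2) x = 2 * (f x * pd i f x).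
Proof.
move=> Ux; apply: pd_val; have df := smooth_is_derive i sf Ux.
rewrite mulr_natl mulr2n.
exact: is_deriveM.
Qed.

Lemma pd_pd_sqr i j x : U x ->
  pd j (pd i (fun z => f z ^+ 2)) x = 2 * (pd j f x * pd i f x + f x * pd j (pd i f) x).
Proof.
move=> Ux; rewrite -(pd_eq_on j oU (fun y Uy => esym (pd_sqr i Uy)) Ux).
apply: pd_val; have df := smooth_is_derive j sf Ux.
have ddf := smooth_is_derive j (smooth_on_pd i sf) Ux.
have alg (a b c d : R) : a * b + c * d = c * d + b * a by ring.
rewrite alg.
exact: (is_deriveZ 2 (is_deriveM df ddf)).
Qed.

Variable phi : 'rV[R]_(2 + 1) -> 'rV[R]_4.
Hypotheses (sphi : smooth_map_on M phi) (fphi : forall x, M x -> row_free (jac phi x))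
  (iso : forall x, M x -> pullback_euclidean phi x = w x).

(** The three clauses serve (i), the constancy of phi_3 / f along the base, and the evaluation of
    the constant in (ii). Both [h] and the normal behind it belong to the single point [x]. *)
Lemma necessity_pointwise x : M x -> let z := lsubmx x in exists h : R,
  [/\ f z ^+ 2 * detH z = h ^+ 2 * (K z * Delta z),
      forall i, second phi (L i) T x = (pd i f z / f z) *: tangent phi T x &
      dot (second phi T T x) (second phi T T x) =
        f z ^+ 2 * (G z * pd 0 f z ^+ 2 - 2 * F z * pd 0 f z * pd 1 f z + E z * pd 1 f
          z ^+ 2)
        / Delta z + h ^+ 2].
Proof.
move=> Mx z; have Uz : U z by case: Mx.
have D0 : Delta z != 0 by rewrite gt_eqF // Delta_gt0.
have f0 : f z != 0 by rewrite gt_eqF // f_gt0.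
have oM := open_product_domain.
have [nu [nn nP uniq]] := @unit_normal R 3 (jac phi x) (fphi Mx).
have Kz : K z * Delta z = lowcurv E F G z.
  by apply: (@gauss_curvature_lowcurv _ E F G U) => // y Uy;
    rewrite gt_eqF // Delta_gt0.
have kD0 : lowcurv E F G z != 0 by rewrite -Kz mulf_neq0 // K0.
have gm i j := dot_tangent iso i j Mx.
have gLL i j : dot (tangent phi (L i) x) (tangent phi (L j) x) = g z i j.
  by rewrite gm block_mxEul.
have gLT i : dot (tangent phi (L i) x) (tangent phi T x) = 0.
  by rewrite gm block_mxEur mxE.
have gTT : dot (tangent phi T x) (tangent phi T x) = f z ^+ 2.
  by rewrite gm block_mxEdr mxE eqxx mulr1n.
have nT i : dot (tangent phi i x) nu = 0 by rewrite -row_jac; exact: nP.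
have kos i j l := koszul oM sphi iso i j l Mx.
have ga i j k l := gauss_equation oM sphi iso i j k l Mx.
have kLL i j l : dot (second phi (L i) (L j) x) (tangent phi (L l) x) = lowchr g i j l
  z.
  by rewrite kos lowchrLLL.
have kLLT i j : dot (second phi (L i) (L j) x) (tangent phi T x) = 0.
  by rewrite kos lowchrLLT.
have kLTL i l : dot (second phi (L i) T x) (tangent phi (L l) x) = 0.
  by rewrite kos lowchrLTL.
have kLTT i : dot (second phi (L i) T x) (tangent phi T x) = f z * pd i f z.
  by rewrite kos lowchrLTT -[LHS]/(2^-1 * pd i (fun z =>
    f z ^+ 2) z) (pd_sqr i Uz) mulKf ?pnatr_eq0.
have kTTL l : dot (second phi T T x) (tangent phi (L l) x) = - (f z * pd l f z).
  by rewrite kos lowchrTTL -[LHS]/(- (2^-1 * pd l (fun z =>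
    f z ^+ 2) z)) (pd_sqr l Uz) mulKf ?pnatr_eq0.
have kTTT : dot (second phi T T x) (tangent phi T x) = 0 by rewrite kos lowchrTTT.
have sym i j := second_sym oM sphi i j Mx.
have gauss1 : dot (second phi (L 1) (L 1) x) (second phi (L 0) (L 0) x) -
    dot (second phi (L 0) (L 1) x) (second phi (L 0) (L 1) x) =
    pd 0 (lowchr g 1 1 0) z - pd 1 (lowchr g 0 1 0) z.
  have := ga (L 1) (L 1) (L 0) (L 0).
  rewrite (lowchrLLL g f 1 1 0) (lowchrLLL g f 1 0 0) !pd_lsubmx_l (sym (L 1) (L 0)) =>
    <-.
  have -> // : lowchr g 1 0 0 = lowchr g 0 1 0.
  by apply/funext => y; rewrite !lowchr_metric2.
have gauss2 i j k : dot (second phi (L i) (L j) x) (second phi (L k) T x) -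
    dot (second phi (L i) (L k) x) (second phi (L j) T x) = 0.
  by have := ga (L i) (L j) (L k) T; rewrite !lowchrLLT !pd_cst subrr => <-.
have gauss3 i j : dot (second phi (L i) (L j) x) (second phi T T x) -
    dot (second phi (L i) T x) (second phi (L j) T x) =
    - (pd i f z * pd j f z + f z * pd j (pd i f) z).
  have := ga (L i) (L j) T T; rewrite lowchrLLT lowchrLTT => <-.
  rewrite pd_cst sub0r; congr (- _).
  rewrite (pd_lsubmx_l (fun v => 2^-1 * pd i (fun z => f z ^+ 2) v)) -/z.
  have sq : smooth_on U (fun z => f z ^+ 2) by exact: smoothX.
  have dd := smooth_is_derive j (smooth_on_pd i sq) Uz.
  rewrite (pd_val (is_deriveZ 2^-1 dd)) (pd_pd_sqr i j Uz).
  have alg (a b c : R) : 2^-1 * (2 * (a * b + c)) = b * a + c by field.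
  exact: alg.
have uniq' u : dot u (tangent phi (L 0) x) = 0 -> dot u (tangent phi (L 1) x) = 0 ->
    dot u (tangent phi T x) = 0 -> dot u nu = 0 -> u = 0.
  move=> u0 u1 uT un; apply: uniq => // i; rewrite row_jac.
  case: (@splitP 2 1 i) => j ij.
    have -> : i = L j by apply: val_inj.
    by have [->|->] := ord2P j; [exact: u0|exact: u1].
  by have -> : i = T by apply: val_inj; rewrite /= ij (ord1 j).
have g00 : dot (tangent phi (L 0) x) (tangent phi (L 0) x) = E z by rewrite gLL mxE.
have g01 : dot (tangent phi (L 0) x) (tangent phi (L 1) x) = F z by rewrite gLL mxE.
have g11 : dot (tangent phi (L 1) x) (tangent phi (L 1) x) = G z by rewrite gLL mxE.
have [h [hK hQ0 hQ1 hQT]] := warped_second_fundamental_form D0 f0 kD0 g00 g01 g11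
  (gLT 0) (gLT 1) gTT (nT (L 0)) (nT (L 1)) (nT T) nn uniq'
  (And3 (kLL 0 0 0) (kLL 0 0 1) (kLLT 0 0))
  (And3 (kLL 0 1 0) (kLL 0 1 1) (kLLT 0 1))
  (And3 (kLL 1 1 0) (kLL 1 1 1) (kLLT 1 1))
  (And3 (kLTL 0 0) (kLTL 0 1) (kLTT 0))
  (And3 (kLTL 1 0) (kLTL 1 1) (kLTT 1))
  (And3 (kTTL 0) (kTTL 1) kTTT)
  gauss1 (gauss2 0 0 1)
  (etrans (congr2 (fun a b => _ - dot a b) (sym (L 0) (L 1)) erefl) (gauss2 1 1 0))
  (gauss3 0 0)
  (etrans (congr2 (fun a b => dot a b - _) (sym (L 0) (L 1)) erefl)
     (etrans (congr1 (fun a => _ - a) (dotC _ _))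
       (etrans (gauss3 1 0) (congr1 (fun a => - (a + _)) (mulrC _ _)))))
  (gauss3 1 1).
exists h; split; last exact: hQT.
- by rewrite Kz !hess_metric2.
- by move=> i; have [->|->] := ord2P i; [exact: hQ0|exact: hQ1].
Qed.

(** * Constancy along the slices x_3 = s *)

Definition slice (z : 'rV[R]_2) (s : R) : 'rV[R]_(2 + 1) := row_mx z (s%:M).

Lemma slice_in z s : U z -> J s -> M (slice z s).
Proof. by move=> Uz Js; split; rewrite /slice ?row_mxKl // row_mxKr mxE eqxx mulr1n.
  Qed.

Lemma slice_shiftl z s (h : R) (i : 'I_2) :
  slice (h *: delta_mx 0 i + z) s = h *: delta_mx 0 (L i) + slice z s.
Proof.
apply/rowP => j; rewrite !mxE; case: (splitP j) => k jk.
  by have -> : j = lshift 1 k by [exact: val_inj]; rewrite !mxE eq_lshift.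
by have -> : j = rshift 2 k by [exact: val_inj]; rewrite eq_rlshift mulr0 add0r.
Qed.

Lemma slice_shiftr z (s : R) : slice z s = slice z 0 + s *: delta_mx 0 T.
Proof.
apply/rowP => j; rewrite !mxE; case: (splitP j) => k jk.
  by have -> : j = lshift 1 k by [exact: val_inj]; rewrite eq_lrshift /= mulr0 addr0.
have -> : j = rshift 2 k by exact: val_inj.
by rewrite (ord1 k) eqxx [X in X = _]mxE [X in _ = X + _]mxE !eqxx mulr1n mul0rn add0r
  mulr1.
Qed.

Lemma is_derive_slicel (u : 'rV[R]_(2 + 1) -> R) z s (i : 'I_2) df :
  is_derive (slice z s) (delta_mx 0 (L i)) u df ->
  is_derive z (delta_mx 0 i) (fun y => u (slice y s)) df.
Proof.
move=> [ud uD].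
have E' : (fun h : R => h^-1 *: (((fun y => u (slice y s)) \o shift z) (h *: delta_mx 0
  i) - u (slice z s)))
  = (fun h : R => h^-1 *: ((u \o shift (slice z s)) (h *: delta_mx 0 (L i)) - u (slice
    z s))).
  by apply/funext => h /=; rewrite slice_shiftl.
apply: DeriveDef; first by rewrite /derivable E'.
by rewrite /derive E'.
Qed.

Lemma is_derive_slicer (u : 'rV[R]_(2 + 1) -> R) z s df :
  is_derive (slice z s) (delta_mx 0 T) u df ->
  is_derive s 1 (fun t => u (slice z t)) df.
Proof.
rewrite slice_shiftr => /is_derive_line; congr is_derive.
by apply/funext => t; rewrite -slice_shiftr.
Qed.

(** The derivative along the base is phi_i3 / f - f_i phi_3 / f^2, which vanishes by the second
    clause of [necessity_pointwise]. *)
Lemma unit_tangent_const z z' s k : U z -> U z' -> J s ->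
  (f z)^-1 * tangent phi T (slice z s) 0 k = (f z')^-1 * tangent phi T (slice z' s) 0 k.
Proof.
move=> Uz Uz' Js.
pose u y := (f y)^-1 * pd T (fun v => phi v 0 k) (slice y s).
have E' y : (f y)^-1 * tangent phi T (slice y s) 0 k = u y by rewrite mxE.
rewrite !E'; apply: (path_connected_pd0_const oU pcU _ Uz Uz') => i y Uy.
have My : M (slice y s) by exact: slice_in.
have [h [_ /(_ i) hQ _]] := necessity_pointwise My.
have f0 : f y != 0 by rewrite gt_eqF // f_gt0.
have df := is_deriveVf f0 (smooth_is_derive i sf Uy).
have dT := is_derive_slicel (smooth_is_derive (L i) (smooth_on_pd T (sphi k)) My).
have := is_deriveM df dT; congr is_derive.
move/rowP/(_ k) : hQ; rewrite /slice row_mxKl [LHS]mxE [RHS]mxE [X in _ * X]mxE => ->.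
move: (pd i f y) (pd T _ _) => a b.
by rewrite -![_ *: _]/(_ * _); field.
Qed.

(** [unit_tangent_const] holds for all values of x_3 near [s], as [J] is open, and f does not depend
    on x_3; the identity can be differentiated in x_3. *)
Lemma principal_vector_const z z' s k : U z -> U z' -> J s ->
  (f z)^-1 * second phi T T (slice z s) 0 k = (f z')^-1 * second phi T T (slice z' s) 0
    k.
Proof.
move=> Uz Uz' Js.
have dT y : U y -> is_derive s 1 (fun t => (f y)^-1 * tangent phi T (slice y t) 0 k)
    ((f y)^-1 * second phi T T (slice y s) 0 k).
  move=> Uy; have My : M (slice y s) by exact: slice_in.
  have := is_derive_slicer (smooth_is_derive T (smooth_on_pd T (sphi k)) My).
  move/(is_deriveZ (f y)^-1); rewrite [X in _ -> is_derive _ _ _ X](_ : _ =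
     (f y)^-1 *: pd T (pd T (fun v => phi v 0 k)) (slice y s)); last by rewrite mxE.
  by congr is_derive; apply/funext => t; rewrite mxE.
have near_eq : \forall t \near s, (f z)^-1 * tangent phi T (slice z t) 0 k =
    (f z')^-1 * tangent phi T (slice z' t) 0 k.
  have := open_nbhs_nbhs (conj oJ Js).
  by apply: filterS => t; exact: unit_tangent_const.
have [_ <-] := dT z Uz; have [_ <-] := dT z' Uz'.
exact: (near_eq_derive _ near_eq).
Qed.

Lemma necessity_conditions :
  (forall x, U x -> 0 <= detH x * K x) /\
  (exists2 c : R, 0 <= c & forall x, U x ->
    detH x + K x * (pd 0 f x ^+ 2 * G x - 2 * pd 0 f x * pd 1 f x * F x + pd 1 f x ^+ 2
      * E x)
    = c * K x * Delta x).
Proof.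
(* Neither condition involves x_3, so one slice suffices; the constant is read off at [z0]. *)
have [s Js] := J0; have [[z0 Uz0] _] := pcU.
have pw z (Uz : U z) := necessity_pointwise (slice_in Uz Js).
rewrite /slice /= in pw.
split=> [z Uz|].
  have [h []] := pw z Uz; rewrite row_mxKl => hK _ _.
  have f2 : 0 < f z ^+ 2 by rewrite exprn_gt0 // f_gt0.
  rewrite -(pmulr_rge0 _ f2) mulrA hK.
  have -> : h ^+ 2 * (K z * Delta z) * K z = (h * K z) ^+ 2 * Delta z by ring.
  by rewrite mulr_ge0 ?sqr_ge0 // ltW // Delta_gt0.
pose V z : 'rV[R]_4 := (f z)^-1 *: second phi T T (slice z s).
have Vc z : U z -> V z = V z0.
  by move=> Uz; apply/rowP => k; rewrite [LHS]mxE [RHS]mxE;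
    exact: (principal_vector_const k Uz Uz0 Js).
exists (dot (V z0) (V z0)); first exact: dot_ge0.
move=> z Uz; rewrite -(Vc z Uz) /V dotZl dotC dotZl.
have [h [hK _ hV]] := pw z Uz; rewrite {1}/slice hV.
rewrite row_mxKl in hK *.
have f0 : f z != 0 by rewrite gt_eqF // f_gt0.
have D0 : Delta z != 0 by rewrite gt_eqF // Delta_gt0.
have -> : detH z = h ^+ 2 * (K z * Delta z) / f z ^+ 2.
  by rewrite -hK [RHS]mulrC mulKf // expf_neq0.
move: (pd 0 f z) (pd 1 f z) (K z) f0 D0 => p q r; move: (E z) (F z) (G z) (f z) => *.
by field; apply/andP.
Qed.

End Necessity.

(** * Flat metrics *)

(** Cartan's second structure equation in coordinates. The coframe is th1 = a dx_1 + b dx_2, th2 = e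
    dx_2, and om = p dx_1 + q dx_2 is fixed by d th1 = om ^ th2 and d th2 = - om ^ th1, the
    hypotheses on [p * e] and [q * a]. The curvature expression equals a e (p1 - q0). Suffixes 0 and
    1 denote partial derivatives. *)
Lemma connection_form_closed (R : fieldType)
  (a b e a0 a1 b0 b1 e0 e1 a01 a11 b00 b01 e00 p q p0 p1 q0 : R) :
  a != 0 -> e != 0 ->
  p * e = b0 - a1 -> q * a = p * b + e0 ->
  p * e1 + e * p1 = b01 - a11 -> p * e0 + e * p0 = b00 - a01 ->
  q * a0 + a * q0 = p * b0 + b * p0 + e00 ->
  let E := a ^+ 2 in let F := a * b in let G := b ^+ 2 + e ^+ 2 in
  let g000 := a * a0 in let g001 := a0 * b + a * b0 - a * a1 in
  let g010 := a * a1 in let g011 := b * b0 + e * e0 in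
  let g110 := a1 * b + a * b1 - (b * b0 + e * e0) in let g111 := b * b1 + e * e1 in
  (a1 * b0 + b * a01 + (a * b01 + b1 * a0) - (b * b00 + b0 * b0 + (e * e00 + e0 * e0)))
   - (a * a11 + a1 * a1)
   - (G * (g110 * g000 - g010 ^+ 2) - F * (g110 * g001 + g111 * g000 - 2 * g010 * g011)
      + E * (g111 * g001 - g011 ^+ 2)) / (E * G - F ^+ 2) = 0 ->
  p1 = q0.
Proof.
move=> an0 en0 hp hq hp1 hp0 hq0 E F G g000 g001 g010 g011 g110 g111 flat.
have pE : p = (b0 - a1) / e by rewrite -hp; field.
have qE : q = (p * b + e0) / a by rewrite -hq; field.
have p1E : p1 = (b01 - a11 - p * e1) / e by rewrite -hp1; field.
have p0E : p0 = (b00 - a01 - p * e0) / e by rewrite -hp0; field.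
have q0E : q0 = (p * b0 + b * p0 + e00 - q * a0) / a by rewrite -hq0; field.
have D : E * G - F ^+ 2 = (a * e) ^+ 2 by rewrite /E /G /F; ring.
rewrite D in flat.
apply/eqP; rewrite -subr_eq0; apply/eqP.
apply: (mulfI (mulf_neq0 an0 en0)); rewrite mulr0 -flat.
rewrite p1E q0E qE p0E pE /E /F /G /g000 /g001 /g010 /g011 /g110 /g111.
by field; rewrite an0 en0.
Qed.

Section FlatCoordinates.
Context {R : realType}.
Variables (p : 'rV[R]_2) (r : R) (E F G a b e : 'rV[R]_2 -> R).
Local Notation B := (ball p r).
Hypotheses (r0 : 0 < r) (sa : smooth_on B a) (sb : smooth_on B b) (se : smooth_on B e)
  (a0 : forall x, B x -> a x != 0) (e0 : forall x, B x -> e x != 0)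
  (Ea : forall x, B x -> E x = a x ^+ 2) (Fa : forall x, B x -> F x = a x * b x)
  (Ga : forall x, B x -> G x = b x ^+ 2 + e x ^+ 2)
  (flat : forall x, B x -> lowcurv E F G x = 0).

Let oB : open B. Proof. exact: ball_open. Qed.

Lemma pd_mul (U : set 'rV[R]_2) (u v : 'rV[R]_2 -> R) i x :
  smooth_on U u -> smooth_on U v -> U x ->
  is_derive x (delta_mx 0 i) (fun y => u y * v y) (u x * pd i v x + v x * pd i u x).
Proof.
move=> su sv Ux.
exact: (is_deriveM (smooth_is_derive i su Ux) (smooth_is_derive i sv Ux)).
Qed.

Let pdE i x : B x -> pd i E x = 2 * (a x * pd i a x).
Proof.
move=> Bx; rewrite (pd_eq_on i oB Ea Bx) mulr_natl mulr2n.
exact: (pd_val (pd_mul i sa sa Bx)).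
Qed.

Let pdF i x : B x -> pd i F x = a x * pd i b x + b x * pd i a x.
Proof.
move=> Bx; rewrite (pd_eq_on i oB Fa Bx).
exact: (pd_val (pd_mul i sa sb Bx)).
Qed.

Let pdG i x : B x -> pd i G x = 2 * (b x * pd i b x + e x * pd i e x).
Proof.
move=> Bx; rewrite (pd_eq_on i oB Ga Bx) mulr_natl mulr2n addrACA.
exact: (pd_val (is_deriveD (pd_mul i sb sb Bx) (pd_mul i se se Bx))).
Qed.

Let g110 x : B x -> lowchr (metric2 E F G) 1 1 0 x =
  pd 1 a x * b x + a x * pd 1 b x - (b x * pd 0 b x + e x * pd 0 e x).
Proof.
move=> Bx; rewrite lowchr_metric2 pdF // pdG //.
move: (pd 1 a x) (pd 1 b x) (pd 0 b x) (pd 0 e x) => *; by field.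
Qed.

Let g010 x : B x -> lowchr (metric2 E F G) 0 1 0 x = a x * pd 1 a x.
Proof. by move=> Bx; rewrite lowchr_metric2 pdE //; move: (pd 1 a x) => *; field. Qed.

(** The components of the connection form, solved from the first structure equations of the coframe
    a dx_1 + b dx_2, e dx_2. *)
Let om0 x := (pd 0 b x - pd 1 a x) / e x.
Let om1 x := (om0 x * b x + pd 0 e x) / a x.

Let som0 : smooth_on B om0.
Proof.
apply: (smoothM oB (smoothB oB (smooth_on_pd 0 sb) (smooth_on_pd 1 sa))).
exact: smoothV.
Qed.

Let som1 : smooth_on B om1.
Proof.
apply: (smoothM oB (smoothD oB (smoothM oB som0 sb) (smooth_on_pd 0 se))).
exact: smoothV.
Qed.

Let om0E x : B x -> om0 x * e x = pd 0 b x - pd 1 a x.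
Proof. by move=> Bx; rewrite /om0 mulfVK // e0. Qed.

Let om1E x : B x -> om1 x * a x = om0 x * b x + pd 0 e x.
Proof. by move=> Bx; rewrite /om1 mulfVK // a0. Qed.

Let om_closed x : B x -> pd 1 om0 x = pd 0 om1 x.
Proof.
move=> Bx.
(* The structure equations are differentiated in product form, which avoids differentiating the
   quotients defining [om0] and [om1]. *)
have D1 i : om0 x * pd i e x + e x * pd i om0 x = pd i (pd 0 b) x - pd i (pd 1 a) x.
  rewrite -(pd_val (pd_mul i som0 se Bx)) (pd_eq_on i oB om0E Bx).
  exact: (pd_val (is_deriveB (smooth_is_derive i (smooth_on_pd 0 sb) Bx)
    (smooth_is_derive i (smooth_on_pd 1 sa) Bx))).
have D2 : om1 x * pd 0 a x + a x * pd 0 om1 x =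
    om0 x * pd 0 b x + b x * pd 0 om0 x + pd 0 (pd 0 e) x.
  rewrite -(pd_val (pd_mul 0 som1 sa Bx)) (pd_eq_on 0 oB om1E Bx).
  exact: (pd_val (is_deriveD (pd_mul 0 som0 sb Bx) (smooth_is_derive 0 (smooth_on_pd 0
    se) Bx))).
have L1 : pd 0 (lowchr (metric2 E F G) 1 1 0) x =
    pd 1 a x * pd 0 b x + b x * pd 0 (pd 1 a) x + (a x * pd 0 (pd 1 b) x + pd 1 b x *
      pd 0 a x)
    - (b x * pd 0 (pd 0 b) x + pd 0 b x * pd 0 b x + (e x * pd 0 (pd 0 e) x + pd 0 e x
      * pd 0 e x)).
  rewrite (pd_eq_on 0 oB g110 Bx); apply: pd_val; apply: is_deriveB; apply: is_deriveD.
  - exact: (pd_mul 0 (smooth_on_pd 1 sa) sb Bx).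
  - exact: (pd_mul 0 sa (smooth_on_pd 1 sb) Bx).
  - exact: (pd_mul 0 sb (smooth_on_pd 0 sb) Bx).
  - exact: (pd_mul 0 se (smooth_on_pd 0 se) Bx).
have L2 : pd 1 (lowchr (metric2 E F G) 0 1 0) x = a x * pd 1 (pd 1 a) x + pd 1 a x * pd
  1 a x.
  rewrite (pd_eq_on 1 oB g010 Bx).
  exact: (pd_val (pd_mul 1 sa (smooth_on_pd 1 sa) Bx)).
have := flat Bx; rewrite /lowcurv L1 L2 (g110 Bx) (g010 Bx) !lowchr_metric2.
rewrite !pdE // !pdF // !pdG // Ea // Fa // Ga // => fl.
have D11 := D1 1; rewrite (schwarz 1 0 oB sb Bx) in D11.
apply: (connection_form_closed (b1 := pd 1 b x) (a0 Bx) (e0 Bx) (om0E Bx) (om1E Bx) D11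
  (D1 0) D2).
apply: etrans _ fl.
move: (pd 0 (pd 1 a) x) (pd 1 (pd 1 a) x) (pd 0 (pd 1 b) x) (pd 0 (pd 0 b) x) (pd 0 (pd
  0 e) x).
move: (pd 0 a x) (pd 1 a x) (pd 0 b x) (pd 1 b x) (pd 0 e x) (pd 1 e x) (a x) (b x) (e
  x) => *.
by congr (_ - _ / _); field.
Qed.

(** Rotation by an angle [al] with d al = om turns the first structure equations into closedness of
    both forms of the coframe, and leaves the sum of their squares unchanged. The radius is halved
    twice, once for [al] and once for the coordinates [y]. *)
Lemma flat_coordinates : exists y P Q : 'I_2 -> 'rV[R]_2 -> R,
  (forall k, smooth_on (ball p (r / 2 / 2)) (P k) /\ smooth_on (ball p (r / 2 / 2)) (Q
    k)) /\
  forall x, ball p (r / 2 / 2) x ->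
  [/\ forall k, is_derive x (delta_mx 0 0) (y k) (P k x) /\
                is_derive x (delta_mx 0 1) (y k) (Q k x),
      E x = P 0 x ^+ 2 + P 1 x ^+ 2, F x = P 0 x * Q 0 x + P 1 x * Q 1 x &
      G x = Q 0 x ^+ 2 + Q 1 x ^+ 2].
Proof.
have [al dal] := poincare r0 som0 som1 om_closed.
pose C := ball p (r / 2).
have oC : open C by exact: ball_open.
have r2 : r / 2 <= r by have := r0; lra.
have r4 : r / 2 / 2 <= r by have := r0; lra.
have CB : C `<=` B by exact: le_ball.
have sC u : smooth_on B u -> smooth_on C u by exact: smooth_on_sub.
have sal : smooth_on C al.
  apply: (smooth_of_pd (df := fun i => if i == 0 then om0 else om1) oC).
    move=> i x Cx; have [d0 d1] := dal x Cx.
    by have [->|->] := ord2P i.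
  by move=> i; case: ifP => _; exact: sC.
have pal0 x : C x -> pd 0 al x = om0 x by move=> /dal[/pd_val].
have pal1 x : C x -> pd 1 al x = om1 x by move=> /dal[_ /pd_val].
have ssin := smooth_sin oC sal; have scos := smooth_cos oC sal.
have dsin i x : C x -> is_derive x (delta_mx 0 i) (fun x =>
  sin (al x)) (cos (al x) * pd i al x).
  by move=> Cx; apply: is_derive_comp1; exact: (smooth_is_derive i sal Cx).
have dcos i x : C x -> is_derive x (delta_mx 0 i) (fun x =>
  cos (al x)) (- sin (al x) * pd i al x).
  by move=> Cx; apply: is_derive_comp1; exact: (smooth_is_derive i sal Cx).
have da i x (Cx : C x) := smooth_is_derive i (sC _ sa) Cx.
have db i x (Cx : C x) := smooth_is_derive i (sC _ sb) Cx.
have de i x (Cx : C x) := smooth_is_derive i (sC _ se) Cx.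
pose P0 x := cos (al x) * a x.
pose Q0 x := cos (al x) * b x - sin (al x) * e x.
pose P1 x := sin (al x) * a x.
pose Q1 x := sin (al x) * b x + cos (al x) * e x.
have sP0 : smooth_on C P0 by exact: (smoothM oC scos (sC _ sa)).
have sP1 : smooth_on C P1 by exact: (smoothM oC ssin (sC _ sa)).
have sQ0 : smooth_on C Q0 by exact: (smoothB oC (smoothM oC scos (sC _ sb)) (smoothM oC
  ssin (sC _ se))).
have sQ1 : smooth_on C Q1 by exact: (smoothD oC (smoothM oC ssin (sC _ sb)) (smoothM oC
  scos (sC _ se))).
have structure x : C x -> pd 1 a x = pd 0 b x - om0 x * e x /\ pd 0 e x = om1 x * a x -
  om0 x * b x.
  by move=> /CB Bx; rewrite om0E // om1E //; split; ring.
have cl0 x : C x -> pd 1 P0 x = pd 0 Q0 x.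
  move=> Cx; rewrite (pd_val (is_deriveM (dcos 1 x Cx) (da 1 x Cx))).
  rewrite (pd_val (is_deriveB (is_deriveM (dcos 0 x Cx) (db 0 x Cx)) (is_deriveM (dsin
    0 x Cx) (de 0 x Cx)))).
  rewrite pal0 // pal1 //; have [-> ->] := structure x Cx.
  rewrite -![_ *: _]/(_ * _).
  by move: (pd 0 b x) (om0 x) (om1 x) (sin (al x)) (cos (al x)) => *; ring.
have cl1 x : C x -> pd 1 P1 x = pd 0 Q1 x.
  move=> Cx; rewrite (pd_val (is_deriveM (dsin 1 x Cx) (da 1 x Cx))).
  rewrite (pd_val (is_deriveD (is_deriveM (dsin 0 x Cx) (db 0 x Cx)) (is_deriveM (dcos
    0 x Cx) (de 0 x Cx)))).
  rewrite pal0 // pal1 //; have [-> ->] := structure x Cx.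
  rewrite -![_ *: _]/(_ * _).
  by move: (pd 0 b x) (om0 x) (om1 x) (sin (al x)) (cos (al x)) => *; ring.
have r20 : 0 < r / 2 by rewrite divr_gt0.
have [y0 dy0] := poincare r20 sP0 sQ0 cl0.
have [y1 dy1] := poincare r20 sP1 sQ1 cl1.
exists (fun k => if k == 0 then y0 else y1), (fun k => if k == 0 then P0 else P1),
  (fun k => if k == 0 then Q0 else Q1).
have DC : ball p (r / 2 / 2) `<=` C by apply: le_ball; lra.
split=> [k|x xD].
  by case: ifP => _; split; apply: (smooth_on_sub DC).
have Bx : B x by exact: (le_ball r4 xD).
split.
- by move=> k; case: ifP => _; [exact: dy0|exact: dy1].
- rewrite Ea //= /P0 /P1.
  transitivity (((cos (al x)) ^+ 2 + (sin (al x)) ^+ 2) * a x ^+ 2); last ring.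
  by rewrite cos2Dsin2 mul1r.
- rewrite Fa //= /P0 /P1 /Q0 /Q1.
  transitivity (((cos (al x)) ^+ 2 + (sin (al x)) ^+ 2) * (a x * b x)); last ring.
  by rewrite cos2Dsin2 mul1r.
- rewrite Ga //= /Q0 /Q1.
  transitivity (((cos (al x)) ^+ 2 + (sin (al x)) ^+ 2) * (b x ^+ 2 + e x ^+ 2));
    last ring.
  by rewrite cos2Dsin2 mul1r.
Qed.

End FlatCoordinates.

(** * Sufficiency *)

(** With primes for g - df^2 / c, the left side is kD - D det H / (c D - quad), and (ii) says det H
    = kD (c D - quad) / D. [L] is the derivative part of the curvature, the letters a, b, c with
    indices are lowered Christoffel symbols. *)
Lemma darboux_flat_algebra (R : fieldType)
  (E F G f0 f1 f00 f01 f11 a0 a1 b0 b1 c0 c1 L c : R) :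
  let D := E * G - F ^+ 2 in
  let kD := L - (G * (c0 * a0 - b0 ^+ 2) - F * (c0 * a1 + c1 * a0 - 2 * b0 * b1)
                  + E * (c1 * a1 - b1 ^+ 2)) / D in
  let quad := f0 ^+ 2 * G - 2 * f0 * f1 * F + f1 ^+ 2 * E in
  let H u0 u1 fij := fij - ((G * u0 - F * u1) / D * f0 + (E * u1 - F * u0) / D * f1) in
  let E' := E - f0 ^+ 2 / c in let F' := F - f0 * f1 / c in let G' := G - f1 ^+ 2 / c in
  let D' := E' * G' - F' ^+ 2 in
  D != 0 -> c != 0 -> D' != 0 ->
  (H a0 a1 f00 * H c0 c1 f11 - H b0 b1 f01 ^+ 2) + kD / D * quad = c * kD ->
  let a0' := a0 - f00 * f0 / c in let a1' := a1 - f00 * f1 / c in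
  let b0' := b0 - f01 * f0 / c in let b1' := b1 - f01 * f1 / c in
  let c0' := c0 - f11 * f0 / c in let c1' := c1 - f11 * f1 / c in
  L - (f00 * f11 - f01 ^+ 2) / c -
   (G' * (c0' * a0' - b0' ^+ 2) - F' * (c0' * a1' + c1' * a0' - 2 * b0' * b1')
                  + E' * (c1' * a1' - b1' ^+ 2)) / D' = 0.
Proof.
move=> D kD quad H E' F' G' D' D0 c0n D'0 cond a0' a1' b0' b1' c0' c1'.
have D'E : D' = (c * D - quad) / c by rewrite /D' /E' /F' /G' /quad /D; field.
have cq : c * D - quad != 0.
  by apply: contra_neq D'0 => h; rewrite D'E h mul0r.
transitivity (kD - D * (H a0 a1 f00 * H c0 c1 f11 - H b0 b1 f01 ^+ 2) / (c * D - quad)).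
  rewrite D'E /kD /H /E' /F' /G' /a0' /a1' /b0' /b1' /c0' /c1'.
  rewrite /quad in cq *. rewrite /D in D0 cq *.
  by field; rewrite cq D0 c0n.
have -> : H a0 a1 f00 * H c0 c1 f11 - H b0 b1 f01 ^+ 2 = c * kD - kD / D * quad.
  by rewrite -cond addrK.
by field; rewrite cq D0.
Qed.

(** [ff] and [fl] stand for the second and first derivatives of f at [x]; the hypotheses are the
    product rule for the entries of g - df^2 / c. *)
Lemma lowchr_metric2_sub (R : realType) (A B D E F G : 'rV[R]_2 -> R) x (c : R)
    (ff : 'I_2 -> 'I_2 -> R) (fl : 'I_2 -> R) : c != 0 -> ff 1 0 = ff 0 1 ->
  (forall i, pd i A x = pd i E x - 2 * (fl 0 * ff i 0) / c) ->
  (forall i, pd i B x = pd i F x - (fl 0 * ff i 1 + fl 1 * ff i 0) / c) ->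
  (forall i, pd i D x = pd i G x - 2 * (fl 1 * ff i 1) / c) ->
  forall i j l, lowchr (metric2 A B D) i j l x =
    lowchr (metric2 E F G) i j l x - ff i j * fl l / c.
Proof.
move=> cn s pA pB pD i j l.
have [[[[[[[l0 l1] l2] l3] l4] l5] l6] l7] := lowchr_metric2 A B D x.
have [[[[[[[m0 m1] m2] m3] m4] m5] m6] m7] := lowchr_metric2 E F G x.
have [->|->] := ord2P i; have [->|->] := ord2P j; have [->|->] := ord2P l;
  [rewrite l0 m0|rewrite l1 m1|rewrite l2 m2|rewrite l3 m3|rewrite l4 m4|rewrite l5
    m5|rewrite l6 m6|rewrite l7 m7];
  rewrite ?pA ?pB ?pD ?s;
  move: (ff 0 0) (ff 0 1) (ff 1 1) (fl 0) (fl 1) (pd 0 E x) (pd 1 E x)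
    (pd 0 F x) (pd 1 F x) (pd 0 G x) (pd 1 G x) => *; by field.
Qed.

Section Sufficiency.
Context {R : realType}.
Variables (U : set 'rV[R]_2) (J : set R) (E F G f : 'rV[R]_2 -> R).
Hypotheses (oU : open U) (oJ : open J) (U0 : U !=set0)
  (sE : smooth_on U E) (sF : smooth_on U F) (sG : smooth_on U G) (sf : smooth_on U f)
  (f_gt0 : forall x, U x -> 0 < f x)
  (mg : riemannian_metric U (metric2 E F G)).
Local Notation g := (metric2 E F G).
Local Notation K := (gauss_curvature g).
Local Notation Delta := (fun x => E x * G x - F x ^+ 2).
Local Notation M := (product_domain U J).
Local Notation w := (warped_metric g f).
Local Notation L i := (lshift 1 i : 'I_(2 + 1)).
Local Notation T := (rshift 2 0 : 'I_(2 + 1)).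
Local Notation detH := (fun x => hess g f 0 0 x * hess g f 1 1 x - hess g f 0 1 x ^+ 2).
Local Notation f0 := (pd 0 f).
Local Notation f1 := (pd 1 f).
Local Notation quad := (fun x => f0 x ^+ 2 * G x - 2 * f0 x * f1 x * F x + f1 x ^+ 2 *
  E x).

Variable c : R.
Hypotheses (HK : forall x, U x -> 0 < detH x * K x)
  (cond : forall x, U x -> detH x + K x * quad x = c * K x * Delta x).

(** Completing the square; it gives both the sign of [quad] and, by dropping the square, the
    positivity of the reduced [E']. *)
Lemma E_quad x : E x * quad x = (E x * f1 x - F x * f0 x) ^+ 2 + Delta x * f0 x ^+ 2.
Proof. by move: (f0 x) (f1 x) (E x) (F x) (G x) => *; ring. Qed.

(** Substituting (ii) into the strict inequality gives K^2 (c Delta - quad) > 0. *)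
Lemma quad_lt x : U x -> quad x < c * Delta x.
Proof.
move=> Ux; rewrite -subr_gt0.
have K0 : K x != 0 by apply/eqP => K0; have := HK Ux; rewrite K0 mulr0 ltxx.
have K2 : 0 < K x ^+ 2 by rewrite lt_neqAle sqr_ge0 eq_sym sqrf_eq0 K0.
rewrite -(pmulr_rgt0 _ K2).
have := HK Ux; congr (0 < _).
have -> : detH x = c * K x * Delta x - K x * quad x by rewrite -cond // addrK.
by move: (K x) (Delta x) (quad x) => *; ring.
Qed.

Lemma quad_ge0 x : U x -> 0 <= quad x.
Proof.
move=> Ux; have [E0 D0] := riemannian_metric2 mg Ux.
by rewrite -(pmulr_rge0 _ E0) E_quad addr_ge0 ?sqr_ge0 // mulr_ge0 ?sqr_ge0 // ltW.
Qed.

Lemma c_gt0 : 0 < c.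
Proof.
have [x Ux] := U0; have [_ D0] := riemannian_metric2 mg Ux.
by rewrite -(pmulr_lgt0 _ D0); apply: le_lt_trans (quad_lt Ux); exact: quad_ge0.
Qed.

Let E' x := E x - f0 x ^+ 2 / c.
Let F' x := F x - f0 x * f1 x / c.
Let G' x := G x - f1 x ^+ 2 / c.

Lemma reduced_Delta x : E' x * G' x - F' x ^+ 2 = (c * Delta x - quad x) / c.
Proof.
rewrite /E' /F' /G'; have := c_gt0; move: (f0 x) (f1 x) (E x) (F x) (G x) c =>
  a b d e h k k0.
by field; rewrite gt_eqF.
Qed.

Lemma reduced_Delta_gt0 x : U x -> 0 < E' x * G' x - F' x ^+ 2.
Proof. by move=> Ux; rewrite reduced_Delta divr_gt0 ?c_gt0 // subr_gt0 quad_lt. Qed.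

(** Delta f_1^2 <= E quad < c E Delta, with f_1 the derivative along x_1, and Delta can be
    cancelled. *)
Lemma reduced_E_gt0 x : U x -> 0 < E' x.
Proof.
move=> Ux; have [E0 D0] := riemannian_metric2 mg Ux.
have -> : E' x = (c * E x - f0 x ^+ 2) / c.
  rewrite /E'; have := c_gt0; move: (f0 x) (E x) c => a b k k0.
  by field; rewrite gt_eqF.
rewrite divr_gt0 ?c_gt0 // subr_gt0 -(ltr_pM2l D0).
apply: (@le_lt_trans _ _ (E x * quad x)); first by rewrite E_quad lerDr sqr_ge0.
apply: (@lt_le_trans _ _ (E x * (c * Delta x))); first by rewrite ltr_pM2l // quad_lt.
by rewrite le_eqVlt; apply/orP; left; apply/eqP; ring.
Qed.

Lemma schwarz_f x : U x -> pd 1 f0 x = pd 0 f1 x.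
Proof. by move=> Ux; exact: (schwarz 1 0 oU sf Ux). Qed.

Lemma is_derive_divr n (h : 'rV[R]_n -> R) (k : R) x v dh : is_derive x v h dh ->
  is_derive x v (fun y => h y / k) (dh / k).
Proof.
move=> /(is_deriveZ k^-1) [hd hD].
have e : (k^-1 \*: h) = (fun y => h y / k) by apply/funext => y; rewrite [RHS]mulrC.
rewrite e in hd hD.
by apply: DeriveDef; rewrite // hD [RHS]mulrC.
Qed.

Lemma is_derive_reduced (u v : 'I_2) (h : 'rV[R]_2 -> R) i x : smooth_on U h -> U x ->
  is_derive x (delta_mx 0 i) (fun y => h y - pd u f y * pd v f y / c)
   (pd i h x - (pd u f x * pd i (pd v f) x + pd v f x * pd i (pd u f) x) / c).
Proof.
move=> sh Ux; have dh := smooth_is_derive i sh Ux.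
have dm := pd_mul i (smooth_on_pd u sf) (smooth_on_pd v sf) Ux.
exact: (is_deriveB dh (is_derive_divr c dm)).
Qed.

Lemma pd_reduced i x : U x ->
  [/\ pd i E' x = pd i E x - 2 * (f0 x * pd i f0 x) / c,
      pd i F' x = pd i F x - (f0 x * pd i f1 x + f1 x * pd i f0 x) / c &
      pd i G' x = pd i G x - 2 * (f1 x * pd i f1 x) / c].
Proof.
move=> Ux; split.
- rewrite mulr_natl mulr2n; exact: (pd_val (is_derive_reduced 0 0 i sE Ux)).
- exact: (pd_val (is_derive_reduced 0 1 i sF Ux)).
- rewrite mulr_natl mulr2n; exact: (pd_val (is_derive_reduced 1 1 i sG Ux)).
Qed.

Local Notation g' := (metric2 E' F' G').

Lemma lowchr_reduced i j l x : U x ->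
  lowchr g' i j l x = lowchr g i j l x - pd i (pd j f) x * pd l f x / c.
Proof.
move=> Ux; have cn : c != 0 := lt0r_neq0 c_gt0.
have s := schwarz_f Ux.
have pE k := let: And3 h _ _ := pd_reduced k Ux in h.
have pF k := let: And3 _ h _ := pd_reduced k Ux in h.
have pG k := let: And3 _ _ h := pd_reduced k Ux in h.
exact: (@lowchr_metric2_sub R E' F' G' E F G x c (fun i j => pd i (pd j f) x)
  (fun l => pd l f x) cn s pE pF pG i j l).
Qed.

(** The third derivatives of f cancel by symmetry, so the derivative part of the curvature changes
    by -(f_11 f_22 - f_12^2) / c only; the rest is [darboux_flat_algebra]. *)
Lemma lowcurv_reduced x : U x -> lowcurv E' F' G' x = 0.
Proof.
move=> Ux; have cn : c != 0 := lt0r_neq0 c_gt0.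
have [_ /gt_eqF/negbT D0] := riemannian_metric2 mg Ux.
have D'0 := negbT (gt_eqF (reduced_Delta_gt0 Ux)).
have sg i j : smooth_on U (fun x => g x i j).
  by have [->|->] := ord2P i; have [->|->] := ord2P j; rewrite metric2E.
have pl i j : pd i (lowchr g' j 1 0) x = pd i (lowchr g j 1 0) x -
   (pd j f1 x * pd i f0 x + f0 x * pd i (pd j f1) x) / c.
  rewrite (pd_eq_on i oU (fun y Uy => lowchr_reduced j 1 0 Uy) Ux).
  have dh := smooth_is_derive i (smooth_lowchr j 1 0 oU sg) Ux.
  have dm := pd_mul i (smooth_on_pd j (smooth_on_pd 1 sf)) (smooth_on_pd 0 sf) Ux.
  exact: (pd_val (is_deriveB dh (is_derive_divr c dm))).
have Kz : K x * Delta x = lowcurv E F G x.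
  by apply: (@gauss_curvature_lowcurv _ E F G U) => // y Uy; have [_ /gt_eqF/negbT] :=
    riemannian_metric2 mg Uy.
have cnd := cond Ux.
rewrite (hess_metric2 f mg 0 0 Ux) (hess_metric2 f mg 1 1 Ux) (hess_metric2 f mg 0 1
  Ux) in cnd.
have KE : K x = lowcurv E F G x / Delta x by rewrite -Kz (mulfK D0).
have cK : c * K x * Delta x = c * lowcurv E F G x by rewrite -mulrA Kz.
move: {cnd} (etrans cnd cK); rewrite KE => cnd.
rewrite /lowcurv in cnd *.
rewrite (pl 0 1) (pl 1 0) (lowchr_reduced 1 1 0 Ux) (lowchr_reduced 0 0 0 Ux)
  (lowchr_reduced 0 1 0 Ux) (lowchr_reduced 0 0 1 Ux) (lowchr_reduced 1 1 1 Ux)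
  (lowchr_reduced 0 1 1 Ux) (schwarz_f Ux) (schwarz 0 1 oU (smooth_on_pd 1 sf) Ux).
have da := darboux_flat_algebra D0 cn D'0 cnd.
apply: etrans _ da.
congr (_ - _).
move: (pd 0 f0 x) (pd 0 f1 x) (pd 1 f1 x) (f0 x) (f1 x) (pd 1 (pd 0 f1) x) (pd 0
  (lowchr g 1 1 0) x)
  (pd 1 (lowchr g 0 1 0) x) => *.
by field.
Qed.

(** An isometric map is an immersion: [v *m A = 0] forces [v *m w x = 0], and the warped metric is
    positive definite. *)
Lemma warped_row_free m (A : 'M[R]_(2 + 1, m)) x : U (lsubmx x) ->
  A *m A^T = w x -> row_free A.
Proof.
move=> Ux AA; apply: inj_row_free => v vA.
have := congr1 (mulmx v) AA; rewrite mulmxA vA mul0mx -{1}[v]hsubmxK.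
rewrite /warped_metric mul_row_block !mulmx0 addr0 add0r => /esym/eqP.
rewrite -[0]row_mx0 => /eqP/eq_row_mx[v1 v2].
rewrite -[v]hsubmxK.
have -> : lsubmx v = 0.
  apply/eqP; apply: contra_eqT v1 => v0.
  have [_ /(_ _ v0)] := mg.2 _ Ux.
  by apply: contraTN => /eqP ->; rewrite mul0mx mxE ltxx.
have -> : rsubmx v = 0.
  move: v2; rewrite mul_mx_scalar => /eqP; rewrite scaler_eq0 => /orP[|/eqP//].
  by rewrite expf_eq0 /= gt_eqF // f_gt0.
by rewrite row_mx0.
Qed.

Lemma sum_ord4 (V : nmodType) (h : 'I_4 -> V) :
  \sum_i h i = h (Ordinal (isT : 0 < 4)%N) + h (Ordinal (isT : 1 < 4)%N)
    + h (Ordinal (isT : 2 < 4)%N) + h (Ordinal (isT : 3 < 4)%N).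
Proof.
by rewrite !big_ord_recl big_ord0 addr0 !addrA; do ![congr (_ + _)]; congr h;
  apply/val_inj.
Qed.

(* In the coordinates (y 0, y 1) the flat metric g - df^2 / c is Euclidean, and
   M is locally the hypersurface of revolution with profile f / sqrt c. *)
Definition rotation_map (y : 'I_2 -> 'rV[R]_2 -> R) (x : 'rV[R]_(2 + 1)) : 'rV[R]_4 :=
  \row_(k < 4) match val k with
    | 0 => f (lsubmx x) * cos (Num.sqrt c * x 0 T) / Num.sqrt c
    | 1 => f (lsubmx x) * sin (Num.sqrt c * x 0 T) / Num.sqrt c
    | 2 => y 0 (lsubmx x)
    | _ => y 1 (lsubmx x)
    end.

Lemma rotation_map_smooth (V : set 'rV[R]_2) y : open V -> V `<=` U ->
  (forall k, smooth_on V (y k)) -> smooth_map_on (product_domain V J) (rotation_map y).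
Proof.
move=> oV VU sy k.
have oW := open_product_domain oV oJ.
have lW (x : 'rV[R]_(2 + 1)) : product_domain V J x -> V (lsubmx x) by case.
have sfl : smooth_on (product_domain V J) (fun x : 'rV[R]_(2 + 1) => f (lsubmx x)).
  exact: (smooth_lift oW (smooth_on_sub VU sf) lW).
have sth : smooth_on (product_domain V J) (fun x : 'rV[R]_(2 + 1) =>
  Num.sqrt c * x 0 T).
  by apply: (smoothM oW (smooth_cst oW _)); exact: smooth_coord.
case: k => -[|[|[|[|k]]]] hk; last by case: (notF hk).
- apply: (smooth_on_eq oW (f := fun x => f (lsubmx x) * cos (Num.sqrt c * x 0 T) /
  Num.sqrt c)).
    by move=> x _; rewrite mxE.
  exact: (smoothM oW (smoothM oW sfl (smooth_cos oW sth)) (smooth_cst oW _)).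
- apply: (smooth_on_eq oW (f := fun x => f (lsubmx x) * sin (Num.sqrt c * x 0 T) /
  Num.sqrt c)).
    by move=> x _; rewrite mxE.
  exact: (smoothM oW (smoothM oW sfl (smooth_sin oW sth)) (smooth_cst oW _)).
- apply: (smooth_on_eq oW (f := fun x => y 0 (lsubmx x)));
  last exact: (smooth_lift oW (sy 0) lW).
  by move=> x _; rewrite mxE.
- apply: (smooth_on_eq oW (f := fun x => y 1 (lsubmx x)));
  last exact: (smooth_lift oW (sy 1) lW).
  by move=> x _; rewrite mxE.
Qed.

(** [t] is the derivative of x_3 in the direction i, 0 or 1, so base and fibre directions are
    treated at once. *)
Lemma rotation_map_pd (y : 'I_2 -> 'rV[R]_2 -> R) i x (df : R) (dy : 'I_2 -> R) :
  is_derive x (delta_mx 0 i) (fun v : 'rV[R]_(2 + 1) => f (lsubmx v)) df ->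
  (forall k, is_derive x (delta_mx 0 i) (fun v : 'rV[R]_(2 + 1) =>
    y k (lsubmx v)) (dy k)) ->
  let s := Num.sqrt c in let t := (i == T)%:R in
  let th := s * x 0 T in
  forall k, jac (rotation_map y) x i k = match val k with
    | 0 => (f (lsubmx x) * (- sin th * (s * t)) + cos th * df) / s
    | 1 => (f (lsubmx x) * (cos th * (s * t)) + sin th * df) / s
    | 2 => dy 0
    | _ => dy 1
    end.
Proof.
move=> fd yd s t th k.
have dth : is_derive x (delta_mx 0 i) (fun v : 'rV[R]_(2 + 1) => s * v 0 T) (s * t).
  have := is_deriveZ s (is_derive_coord x (delta_mx 0 i : 'rV[R]_(2 + 1)) T).
  by rewrite mxE eqxx /= /t eq_sym; exact.
have dcos := is_derive_comp1 (@is_derive_cos R th) dth.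
have dsin := is_derive_comp1 (@is_derive_sin R th) dth.
rewrite mxE; case: k => -[|[|[|[|//]]]] hk.
- rewrite (_ : (fun v => _) = fun v => f (lsubmx v) * cos (s * v 0 T) / s); last first.
    by apply/funext => v; rewrite mxE.
  exact: (pd_val (is_derive_divr s (is_deriveM fd dcos))).
- rewrite (_ : (fun v => _) = fun v => f (lsubmx v) * sin (s * v 0 T) / s); last first.
    by apply/funext => v; rewrite mxE.
  exact: (pd_val (is_derive_divr s (is_deriveM fd dsin))).
- rewrite (_ : (fun v => _) = fun v => y 0 (lsubmx v)); last by apply/funext => v;
  rewrite mxE.
  exact: (pd_val (yd 0)).
- rewrite (_ : (fun v => _) = fun v => y 1 (lsubmx v)); last by apply/funext => v;
  rewrite mxE.
  exact: (pd_val (yd 1)).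
Qed.

(** The two rotating components pull back to df^2 / c + f^2 dx_3^2 by cos^2 + sin^2 = 1, and the
    other two supply g - df^2 / c. *)
Lemma rotation_map_isometric (y P Q : 'I_2 -> 'rV[R]_2 -> R) (x : 'rV[R]_(2 + 1)) :
  let z := lsubmx x in U z ->
  (forall k, is_derive z (delta_mx 0 0) (y k) (P k z) /\ is_derive z (delta_mx 0 1) (y
    k) (Q k z)) ->
  E' z = P 0 z ^+ 2 + P 1 z ^+ 2 -> F' z = P 0 z * Q 0 z + P 1 z * Q 1 z ->
  G' z = Q 0 z ^+ 2 + Q 1 z ^+ 2 ->
  pullback_euclidean (rotation_map y) x = w x.
Proof.
move=> z Uz dy hE hF hG.
pose s := Num.sqrt c; pose th := s * x 0 T.
have s0 : s != 0 by rewrite gt_eqF // sqrtr_gt0 c_gt0.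
have s2 : s ^+ 2 = c by rewrite sqr_sqrtr // ltW // c_gt0.
pose D i := if i == 0 :> 'I_2 then P else Q.
have fl i : is_derive x (delta_mx 0 (L i)) (fun v : 'rV[R]_(2 + 1) =>
  f (lsubmx v)) (pd i f z).
  by apply: is_derive_lsubmx; rewrite lsubmx_delta_l; exact: (smooth_is_derive i sf Uz).
have fr : is_derive x (delta_mx 0 T) (fun v : 'rV[R]_(2 + 1) => f (lsubmx v)) 0.
  by apply: is_derive_lsubmx; rewrite lsubmx_delta_r; exact: is_derive0.
have yl i k : is_derive x (delta_mx 0 (L i)) (fun v : 'rV[R]_(2 + 1) =>
  y k (lsubmx v)) (D i k z).
  apply: is_derive_lsubmx; rewrite lsubmx_delta_l.
  by have [d0 d1] := dy k; have [->|->] := ord2P i; [exact: d0|exact: d1].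
have yr k : is_derive x (delta_mx 0 T) (fun v : 'rV[R]_(2 + 1) => y k (lsubmx v)) 0.
  by apply: is_derive_lsubmx; rewrite lsubmx_delta_r; exact: is_derive0.
have JL i k := rotation_map_pd (fl i) (yl i) k.
have {}JL i k : jac (rotation_map y) x (L i) k = match val k with
    | 0 => cos (th) * pd i f z / s
    | 1 => sin (th) * pd i f z / s
    | 2 => D i 0 z | _ => D i 1 z end.
  rewrite JL.
  by rewrite eq_lrshift !mulr0 !add0r.
have JT k := rotation_map_pd fr yr k.
have {}JT k : jac (rotation_map y) x T k = match val k with
    | 0 => f z * - sin (th)
    | 1 => f z * cos (th)
    | _ => 0 end.
  rewrite JT eqxx mulr1 !mulr0 !addr0.
  case: k => -[|[|[|[|k]]]] hk; [| |by []|by []|by case: (notF hk)].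
    by rewrite [LHS]/= mulrA mulfK.
  by rewrite [LHS]/= mulrA mulfK.
have cs : cos (th) ^+ 2 + sin (th) ^+ 2 = 1 by exact: cos2Dsin2.
have pb i j : pullback_euclidean (rotation_map y) x i j =
    \sum_k jac (rotation_map y) x i k * jac (rotation_map y) x j k.
  by rewrite [LHS]mxE; apply: eq_bigr => k _; congr (_ * _); rewrite [LHS]mxE.
have LL i j : pullback_euclidean (rotation_map y) x (L i) (L j) =
    pd i f z * pd j f z / c + (D i 0 z * D j 0 z + D i 1 z * D j 1 z).
  rewrite pb sum_ord4 !JL /= -s2 -[in RHS](mul1r (pd i f z * _)) -cs.
  move: (cos th) (sin th) (pd i f z) (pd j f z) => *.
  by field.
have LT i : pullback_euclidean (rotation_map y) x (L i) T = 0.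
  rewrite pb sum_ord4 !JL !JT /=; move: (cos th) (sin th) (pd i f z) => *.
  by field.
have TL i : pullback_euclidean (rotation_map y) x T (L i) = 0.
  rewrite pb sum_ord4 !JL !JT /=; move: (cos th) (sin th) (pd i f z) => *.
  by field.
have TT : pullback_euclidean (rotation_map y) x T T = f z ^+ 2.
  rewrite pb sum_ord4 !JT /= -[RHS]mulr1 -cs; move: (cos th) (sin th) => *.
  by ring.
have cn : c != 0 := lt0r_neq0 c_gt0.
apply/matrixP => i j.
case: (@splitP 2 1 i) => i' ii; case: (@splitP 2 1 j) => j' jj.
- have -> : i = L i' by exact: val_inj.
  have -> : j = L j' by exact: val_inj.
  rewrite LL block_mxEul -/z.
  have [->|->] := ord2P i'; have [->|->] := ord2P j'; rewrite mxE /= /D /= -?expr2.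
  + by rewrite -hE /E' addrC subrK.
  + by rewrite -hF /F' addrC subrK.
  + by rewrite (mulrC (Q 0 z)) (mulrC (Q 1 z)) -hF /F' (mulrC (f1 z)) addrC subrK.
  + by rewrite -hG /G' addrC subrK.
- have -> : i = L i' by exact: val_inj.
  have -> : j = T by apply: val_inj; rewrite /= jj (ord1 j').
  by rewrite LT block_mxEur mxE.
- have -> : i = T by apply: val_inj; rewrite /= ii (ord1 i').
  have -> : j = L j' by exact: val_inj.
  by rewrite TL block_mxEdl mxE.
- have -> : i = T by apply: val_inj; rewrite /= ii (ord1 i').
  have -> : j = T by apply: val_inj; rewrite /= jj (ord1 j').
  by rewrite TT block_mxEdr mxE eqxx mulr1n.
Qed.

Lemma local_isometric_embedding : locally_isometrically_embeds 4 M w.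
Proof.
move=> x Mx; have Uz : U (lsubmx x) by case: Mx.
have [r r0 rU] := open_ball_sub oU Uz.
set z0 := lsubmx x in Uz rU.
(* Cholesky factors of the reduced metric: a dx_1 + b dx_2 and e dx_2 form an orthonormal coframe
   for it. *)
pose a v := Num.sqrt (E' v).
pose b v := F' v / a v.
pose e v := Num.sqrt (E' v * G' v - F' v ^+ 2) / a v.
have scV : smooth_on U (fun=> c^-1) by exact: smooth_cst.
have sE' : smooth_on U E'.
  exact: (smoothB oU sE (smoothM oU (smoothX oU 2 (smooth_on_pd 0 sf)) scV)).
have sF' : smooth_on U F'.
  exact: (smoothB oU sF (smoothM oU (smoothM oU (smooth_on_pd 0 sf) (smooth_on_pd 1
    sf)) scV)).
have sG' : smooth_on U G'.
  exact: (smoothB oU sG (smoothM oU (smoothX oU 2 (smooth_on_pd 1 sf)) scV)).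
have a0 v : U v -> a v != 0 by move=> Uv; rewrite gt_eqF // sqrtr_gt0 reduced_E_gt0.
have a2 v : U v -> a v ^+ 2 = E' v by move=> Uv;
  rewrite sqr_sqrtr // ltW // reduced_E_gt0.
have sa : smooth_on U a by exact: (smooth_sqrt oU reduced_E_gt0 sE').
have saV := smoothV oU a0 sa.
have sb : smooth_on U b by exact: (smoothM oU sF' saV).
have sD' : smooth_on U (fun v => E' v * G' v - F' v ^+ 2).
  exact: (smoothB oU (smoothM oU sE' sG') (smoothX oU 2 sF')).
have se : smooth_on U e.
  exact: (smoothM oU (smooth_sqrt oU reduced_Delta_gt0 sD') saV).
have e0 v : U v -> e v != 0.
  move=> Uv; rewrite mulf_neq0 ?invr_neq0 ?a0 //.
  by rewrite gt_eqF // sqrtr_gt0 reduced_Delta_gt0.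
have Fab v : U v -> F' v = a v * b v by move=> Uv; rewrite /b mulrC mulfVK // a0.
have Gbe v : U v -> G' v = b v ^+ 2 + e v ^+ 2.
  move=> Uv; rewrite /b /e !expr_div_n a2 // sqr_sqrtr;
    last by rewrite ltW // reduced_Delta_gt0.
  have := reduced_E_gt0 Uv; move: (E' v) (F' v) (G' v) => h k l h0.
  by field; rewrite gt_eqF.
have sub u : smooth_on U u -> smooth_on (ball z0 r) u by exact: smooth_on_sub.
have [y [P [Q [sPQ H]]]] := @flat_coordinates R z0 r E' F' G' a b e r0 (sub _ sa) (sub
  _ sb) (sub _ se)
  (fun v zv => a0 v (rU v zv)) (fun v zv => e0 v (rU v zv)) (fun v zv =>
    esym (a2 v (rU v zv)))
  (fun v zv => Fab v (rU v zv)) (fun v zv => Gbe v (rU v zv))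
  (fun v zv => lowcurv_reduced (rU v zv)).
pose V := ball z0 (r / 2 / 2).
have oV : open V by exact: ball_open.
have r4 : r / 2 / 2 <= r by lra.
have VU : V `<=` U by move=> v Vv; apply: rU; exact: (le_ball r4 Vv).
have sy k : smooth_on V (y k).
  apply: (smooth_of_pd (df := fun i => if i == 0 then P k else Q k) oV).
    move=> i v Vv; have [/(_ k)[d0 d1] _ _ _] := H v Vv.
    by have [->|->] := ord2P i; [exact: d0|exact: d1].
  by move=> i; have [sp sq] := sPQ k; case: ifP => _; [exact: sp|exact: sq].
have oW := open_product_domain oV oJ.
have iso v : product_domain V J v -> pullback_euclidean (rotation_map y) v = w v.
  move=> [Vv _]; have [dy hE hF hG] := H _ Vv.
  exact: (rotation_map_isometric (VU _ Vv) dy hE hF hG).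
have fr v : product_domain V J v -> row_free (jac (rotation_map y) v).
  by move=> Wv; apply: (warped_row_free (x := v)); [apply: VU; case: Wv|exact: iso].
have Wx : product_domain V J x.
  by split; [apply: ballxx; rewrite !divr_gt0|case: Mx].
(* The angle may make more than a full turn as x_3 runs through [J], so injectivity requires
   shrinking to a small ball around [x]. *)
have [rho [rho0 rhoW emb]] := local_embedding oW (rotation_map_smooth oV VU sy) fr Wx.
exists (ball x rho); split.
- exact: ball_open.
- exact: ballxx.
- by move=> v /rhoW[Vv Jv]; split=> //; exact: VU.
- by exists (rotation_map y); split=> // v /rhoW; exact: iso.
Qed.

End Sufficiency.

Theorem theorem5p3 (R : realType) (U : set 'rV[R]_2) (J : set R)
    (E F G f : 'rV[R]_2 -> R)
    (openU : open U) (scU : simply_connected R U)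
    (openJ : open J) (itvJ : is_interval J) (J0 : J !=set0)
    (smoothE : smooth_on U E) (smoothF : smooth_on U F)
    (smoothG : smooth_on U G) (smoothf : smooth_on U f)
    (f_gt0 : forall x, U x -> 0 < f x)
    (metricg : riemannian_metric U (metric2 E F G))
    (K_neq0 : forall x, U x -> gauss_curvature (metric2 E F G) x != 0) :
  let g := metric2 E F G in
  let K := gauss_curvature g in
  let Delta := fun x => E x * G x - F x ^+ 2 in
  let f1 := pd 0 f in
  let f2 := pd 1 f in
  let detH := fun x => hess g f 0 0 x * hess g f 1 1 x - hess g f 0 1 x ^+ 2 in
  let condition_ii := fun c : R => forall x, U x ->
    detH x + K x * (f1 x ^+ 2 * G x - 2 * f1 x * f2 x * F x + f2 x ^+ 2 * E x)
    = c * K x * Delta x in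
  let M := product_domain U J in
  let ds2 := warped_metric g f in
  (isometrically_embeds 4 M ds2 ->
     (forall x, U x -> 0 <= detH x * K x) /\
     (exists2 c : R, 0 <= c & condition_ii c)) /\
  (forall c : R,
     (forall x, U x -> 0 < detH x * K x) -> condition_ii c ->
     0 < c /\ locally_isometrically_embeds 4 M ds2).
Proof.
move=> g K Delta f1 f2 detH condition_ii M ds2; have [pcU _] := scU; split.
- move=> [phi [[sphi fphi _] iso]].
  exact: (necessity_conditions openU pcU openJ J0 smoothE smoothF smoothG smoothf
    f_gt0 metricg K_neq0 sphi fphi iso).
- move=> c HK cond; split; first exact: (c_gt0 pcU.1 metricg HK cond).
  exact: (local_isometric_embedding openU openJ pcU.1 smoothE smoothF smoothG smoothf
    f_gt0 metricg HK cond).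
Qed.
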